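(* Let $T:(0,1]\to(0,1]$ be defined by $Tx=2^n x-1$ for $x\in(2^{-n},2^{-n+1}]$, $n\in\mathbb{N}$, and $d_1(x)=\lceil-\log_2 x\rceil$. Let $\varphi(x)=\log(d_1(x))$ and for $\xi\in\mathbb{R}$ let $E_\varphi(\xi)=\{x\in(0,1]:\lim_{n\to\infty}\frac1n\sum_{j=0}^{n-1}\varphi(T^jx)=\xi\}$. Let $P(t,q)$ be the pressure function $$P(t,q)=\lim_{n\to\infty}\frac1n\log\sum_{\omega_1,\dots,\omega_n\in\mathbb{N}}\exp\Big(\sup_{x:\,d_1(T^{i-1}x)=\omega_i,\,1\le i\le n}\sum_{j=0}^{n-1}\big(-t\log|T'(T^jx)|+q\varphi(T^jx)\big)\Big).$$ Then $P(t,q)=\log\big(\sum_{n=1}^\infty 2^{-nt}n^q\big)$, and for every $\xi>0$ the system $$P(t,q)=q\xi,\qquad \frac{\partial P}{\partial q}(t,q)=\xi$$ has a unique solution $(t(\xi),q(\xi))$. Moreover $\dim_H E_\varphi(0)=0$ and $\dim_H E_\varphi(\xi)=t(\xi)$ for every $\xi>0$. Let $\xi_0=\int_0^1\log\lceil-\log_2x\rceil\,dx$. Then: (1) $t(\xi_0)=1$; (2) $t'(\xi)>0$ for $0<\xi<\xi_0$, $t'(\xi_0)=0$, and $t'(\xi)<0$ for $\xi>\xi_0$; (3) $\lim_{\xi\to0}t(\xi)=0$ and $\lim_{\xi\to\infty}t(\xi)=0$; (4) $\lim_{\xi\to0}t'(\xi)=\infty$; (5) $t''(\xi_0)<0$ and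 there exists $\xi_1>\xi_0$ with $t''(\xi_1)>0$; in particular $t$ is neither convex nor concave.
   Context: $T'(x)=2^n$ on $(2^{-n},2^{-n+1}]$. The pressure $P$ is considered on the set of $(t,q)$ where the defining series converges. $\dim_H$ is Hausdorff dimension, $\dim_H\emptyset=0$.
   Formalization: d_1(x) is taken as the branch index n for x in (2^{-n},2^{-n+1}], since ⌈-log_2 x⌉ disagrees with T at dyadic endpoints and makes φ(1)=log 0 undefined; the closing ''neither convex nor concave'', immediate from the signs of t'', is not stated separately. *)

(* Defs.v *)
From HB Require Import structures.
From mathcomp Require Import all_boot all_order all_algebra.
From mathcomp Require Import all_classical all_reals all_analysis.
Set Implicit Arguments. Unset Strict Implicit. Unset Printing Implicit Defensive.
Import Order.TTheory GRing.Theory Num.Theory.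
Import numFieldNormedType.Exports.
Local Open Scope classical_set_scope.
Local Open Scope ring_scope.

Section Defs.
Variable R : realType.

(* d_1(x) = n  for x in (2^{-n}, 2^{-n+1}], i.e. floor(-log_2 x) + 1 *)
Definition d1 (x : R) : nat := (`|Num.floor (- (ln x / ln 2))|%N).+1.

Definition Tmap (x : R) : R := 2 ^+ d1 x * x - 1.

Definition Tder (x : R) : R := 2 ^+ d1 x.

Definition phi (x : R) : R := ln (d1 x)%:R.

Definition birkhoff (f : R -> R) (n : nat) (x : R) : R :=
  \sum_(j < n) f (iter j Tmap x).

Definition Ephi (xi : R) : set R :=
  [set x | 0 < x <= 1 /\
     (fun n : nat => n%:R^-1 * birkhoff phi n x) @ \oo --> xi].

Definition cylinder (n : nat) (w : {ffun 'I_n -> nat}) : set R :=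
  [set x | 0 < x <= 1 /\ forall i : 'I_n, d1 (iter i Tmap x) = w i].

Definition Zn (n : nat) (t q : R) : \bar R :=
  \esum_(w in [set w : {ffun 'I_n -> nat} | forall i, (0 < w i)%N])
    expeR (ereal_sup [set (birkhoff (fun y => - t * ln `|Tder y| + q * phi y) n x)%:E
                     | x in cylinder w]).

Definition pdom (t q : R) : Prop := forall n : nat, (0 < n)%N -> (Zn n t q < +oo)%E.

Definition pseq (t q : R) (n : nat) : R := n%:R^-1 * ln (fine (Zn n t q)).

Definition P (t q : R) : R := lim (pseq t q @ \oo).

Definition diam (U : set R) : R := sup [set r | exists x y, U x /\ U y /\ r = `|x - y|].

Definition diam_le (U : set R) (d : R) : Prop :=
  forall x y, U x -> U y -> `|x - y| <= d.

Definition hausdorff_null (s : R) (E : set R) : Prop :=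
  forall eps : R, 0 < eps -> exists U : nat -> set R,
    E `<=` \bigcup_n U n /\ (forall n, diam_le (U n) eps) /\
    (forall N : nat, \sum_(n < N) diam (U n) `^ s <= eps).

Definition dimH (E : set R) : R := inf [set s : R | 0 < s /\ hausdorff_null s E].

End Defs.

(* Main.v *)
(* Write L(t,q) for the sum of 2^(-k t) k^q over k >= 1, so that P = log L. The
   system says that the line of slope xi through the origin is tangent to the
   strictly convex function P(t,.); tangency determines q from t, and t is unique
   because L decreases strictly in t. Along the solution curve t' = q / (dP/dt)
   with dP/dt < 0, so t' has the sign of -q, that is, of xi_0 - xi; the limits of
   t and t' come from elementary bounds on L.

   For the upper bound on the dimension, cover by the cylinders whose Birkhoff
   average is close to xi: if s > t(xi), then L(s,q) < exp(q xi) for some q, and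
   the sum of the s-th powers of their diameters converges geometrically.

   The lower bound is obtained without constructing a measure. The Bernoulli
   weights proportional to 2^(-k t) k^q define additive masses on the binary tree
   of dyadic intervals. Given a cover that is too efficient, compare this mass
   with a summable family of competitors: its tilts q +- lambda with lambda -> 0,
   and its restrictions to the cells of the cover. Some branch keeps all the
   competitors below the main mass; the tilts force its Birkhoff averages to tend
   to xi, and the restrictions force it to avoid the cover. *)
Require Import Defs.
From HB Require Import structures.
From mathcomp Require Import all_boot all_order all_algebra.
From mathcomp Require Import all_classical all_reals all_analysis.
From mathcomp Require Import measurable_realfun.
From mathcomp Require Import ring lra.
Set Implicit Arguments. Unset Strict Implicit. Unset Printing Implicit Defensive.
Import Order.TTheory GRing.Theory Num.Theory.
Import numFieldNormedType.Exports.
Local Open Scope classical_set_scope.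
Local Open Scope ring_scope.

(** The analysis of L rests on a single estimate, [L_quadratic], a second-order Taylor bound jointly
    in t and q. Multiplying the k-th term by k raises q by one, so the t-derivative of L is -ln 2
    times L at q + 1 and no further family of series appears. Increments are kept in factored form,
    so the solution curve is differentiated by Cramer's rule and no two-variable implicit function
    theorem is invoked. A solution is found by minimising t over the region L(t,q) <= exp(q xi); the
    a priori bound |q| <= C t and a positive lower bound on t make the search compact.

    The alphabet is infinite and a dyadic interval may end inside a digit; its mass then contains a
    tail of the digit law, which after r zeros is O(2^(-r s)) for every s < t. Dyadic cells are open
    on the left, so a branch of the tree determines a point only if it has infinitely many ones; the
    competitor tilted towards large digits excludes the other branches.

    In the weighted series the digit d has index d - 1. *)

(** * Sums of real series *)

Section Sums.
Variable R : realType.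
Implicit Types (u v : R^nat) (l m : R).

(** A relation keeps convergence and value together, so that sums are combined and compared without
    side conditions on [limn]. *)
Record sums u l : Prop := Sums { sums_cvg : series u @ \oo --> l }.

Lemma sums_lim u l : sums u l -> limn (series u) = l.
Proof. by move=> [h]; apply/cvg_lim. Qed.

Lemma sums_unique u l m : sums u l -> sums u m -> l = m.
Proof. by move=> /sums_lim <- /sums_lim <-. Qed.

Lemma eq_sums u v l : (forall k, u k = v k) -> sums u l -> sums v l.
Proof. by move=> uv; rewrite (_ : v = u)//; apply/funext => k; rewrite uv. Qed.

Lemma sumsD u v l m : sums u l -> sums v m -> sums (fun k => u k + v k) (l + m).
Proof.
move=> [ul] [vm]; split; rewrite (_ : (fun k => u k + v k) = u + v)// seriesD.
exact: cvgD.
Qed.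

Lemma sumsZ c u l : sums u l -> sums (fun k => c * u k) (c * l).
Proof.
move=> [ul]; split; rewrite (_ : (fun k => c * u k) = c *: u)// seriesZ.
exact: cvgZr.
Qed.

Lemma sumsB u v l m : sums u l -> sums v m -> sums (fun k => u k - v k) (l - m).
Proof.
move=> ul vm; have := sumsD ul (sumsZ (-1) vm).
by rewrite mulN1r; apply: eq_sums => k; rewrite mulN1r.
Qed.

Lemma ler_sums u v l m : (forall k, u k <= v k) -> sums u l -> sums v m -> l <= m.
Proof.
move=> uv ul vm; rewrite -(sums_lim ul) -(sums_lim vm).
by apply: lim_series_le => //; [exact: cvgP (sums_cvg ul)|exact: cvgP (sums_cvg vm)].
Qed.

Lemma sums0 : sums (fun _ => 0) 0.
Proof.
split; rewrite (_ : series _ = fun=> 0); first exact: cvg_cst.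
by apply/funext => n; rewrite /series /= big1.
Qed.

Lemma sums_ge0 u l : (forall k, 0 <= u k) -> sums u l -> 0 <= l.
Proof. by move=> u0 ul; apply: ler_sums sums0 ul. Qed.

Lemma sums_partial u l n : (forall k, 0 <= u k) -> sums u l -> \sum_(k < n) u k <= l.
Proof.
move=> u0 ul; rewrite -(sums_lim ul) -(big_mkord xpredT u).
apply: nondecreasing_cvgn_le; last exact: cvgP (sums_cvg ul).
by apply: nondecreasing_series => *.
Qed.

Lemma sums_term u l n : (forall k, 0 <= u k) -> sums u l -> u n <= l.
Proof.
move=> u0 ul; apply: le_trans (sums_partial n.+1 u0 ul).
by rewrite big_ord_recr/= lerDr sumr_ge0.
Qed.

Lemma sums_gt0 u l n : (forall k, 0 <= u k) -> 0 < u n -> sums u l -> 0 < l.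
Proof. by move=> u0 un ul; exact: lt_le_trans un (sums_term n u0 ul). Qed.

Lemma ltr_sums u v l m n : (forall k, u k <= v k) -> u n < v n ->
  sums u l -> sums v m -> l < m.
Proof.
move=> uv un ul vm; rewrite -subr_gt0; apply: (@sums_gt0 (fun k => v k - u k) _ n).
- by move=> k; rewrite subr_ge0.
- by rewrite subr_gt0.
- exact: sumsB.
Qed.

Lemma ler_norm_sums u v l m : (forall k, `|u k| <= v k) -> sums u l -> sums v m -> `|l| <= m.
Proof.
move=> uv ul vm; rewrite ler_norml; apply/andP; split.
  have := ler_sums _ (sumsZ (-1) vm) ul; rewrite mulN1r; apply => k.
  by rewrite mulN1r; have := uv k; rewrite ler_norml => /andP[].
by apply: ler_sums ul vm => k; have := uv k; rewrite ler_norml => /andP[].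
Qed.

Lemma sums_bounded u M : (forall k, 0 <= u k) -> (forall n, \sum_(k < n) u k <= M) ->
  sums u (limn (series u)) /\ limn (series u) <= M.
Proof.
move=> u0 uM; have nd : nondecreasing_seq (series u) by apply: nondecreasing_series => *.
have c : cvgn (series u).
  apply: nondecreasing_is_cvgn => //; exists M => _ [n _ <-].
  by rewrite /series /= big_mkord.
split; first exact: Sums.
apply: limr_le => //; apply: nearW => n.
by rewrite /series /= big_mkord.
Qed.

Lemma sums_dominated u v m : (forall k, 0 <= u k) -> (forall k, u k <= v k) -> sums v m ->
  sums u (limn (series u)).
Proof.
move=> u0 uv [vm]; split; apply: series_le_cvg (cvgP _ vm) => // k.
exact: le_trans (u0 k) (uv k).
Qed.

End Sums.

(** * The weighted series and their dependence on t and q *)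

Section WeightedSeries.
Variable R : realType.
Implicit Types (t q xi : R) (b k n : nat).

Definition lnS k : R := ln k.+1%:R.

Lemma lnS_ge0 k : 0 <= lnS k.
Proof. by rewrite ln_ge0// ler1n. Qed.

Lemma expR_lnS k : expR (lnS k) = k.+1%:R.
Proof. by rewrite lnK// posrE ltr0n. Qed.

Lemma lnS_le k : lnS k <= k.+1%:R.
Proof. by apply: ltW; apply: ln_sublinear; rewrite ltr0n. Qed.

Lemma ln2_gt0 : 0 < ln 2 :> R.
Proof. by rewrite ln_gt0// ltr1n. Qed.

Lemma ln2_le1 : ln 2 <= 1 :> R.
Proof. by apply: (@le_ln1Dx R 1); lra. Qed.

Lemma powR2E (x : R) : 2 `^ x = expR (x * ln 2).
Proof. by rewrite /powR pnatr_eq0. Qed.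

(** For the digit [k.+1] this is 2^(-(k+1) t) (k+1)^q; written as a single exponential, it lets
    changes of t and q act on the exponent. *)
Definition wt t q k : R := expR (q * lnS k - k.+1%:R * (t * ln 2)).

(** [L 0] is exp P and [L b] its b-th derivative in q; [L 1 / L 0] is the mean of the logarithm of
    the digit under the normalised weights. *)
Definition L b t q : R := limn (series (fun k => lnS k ^+ b * wt t q k)).

Lemma wt_gt0 t q k : 0 < wt t q k.
Proof. exact: expR_gt0. Qed.

Lemma wt_ge0 t q k : 0 <= wt t q k.
Proof. exact: expR_ge0. Qed.

Lemma Lterm_ge0 b t q k : 0 <= lnS k ^+ b * wt t q k.
Proof. by rewrite mulr_ge0 ?exprn_ge0 ?lnS_ge0 ?wt_ge0. Qed.

(** This trades powers of the index for a larger q; powers of logarithms are absorbed in the same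
    way, through [lnSX_le]. *)
Lemma wt_exp t q n k : k.+1%:R ^+ n * wt t q k = wt t (q + n%:R) k.
Proof.
rewrite -expR_lnS -expRM_natl /wt -expRD; congr expR.
by rewrite mulrDl; ring.
Qed.

Lemma le_wt t q t' q' k : t <= t' -> q' <= q -> wt t' q' k <= wt t q k.
Proof.
move=> tt qq; rewrite ler_expR lerB ?ler_wpM2r ?lnS_ge0//.
by rewrite ler_wpM2l// ler_wpM2r// ltW// ln2_gt0.
Qed.

Lemma lnSX_le b k : lnS k ^+ b <= k.+1%:R ^+ b.
Proof. by rewrite lerXn2r ?nnegrE ?lnS_ge0 ?lnS_le. Qed.

Lemma wt_summable t q : 0 < t -> sums (wt t q) (limn (series (wt t q))).
Proof.
move=> t0.
have l2 := ln2_gt0.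
(* With this slope, ln(k+1) <= d (k+1) + |ln d| costs at most half of the geometric decay and leaves
   the ratio 2^(-t/2). *)
pose d := t * ln 2 / (2 * (`|q| + 1)).
have q1 : 0 < `|q| + 1 by rewrite ltr_wpDl.
have d0 : 0 < d by rewrite divr_gt0 ?mulr_gt0.
pose r := expR (- (t * ln 2 / 2)).
pose C := expR (`|q| * `|ln d|).
have r1 : `|r| < 1.
  by rewrite ger0_norm ?expR_ge0// expR_lt1 oppr_lt0 divr_gt0 ?mulr_gt0.
apply: (sums_dominated (v := geometric C r)); last exact/Sums/cvg_geometric_series.
- by move=> k; rewrite wt_ge0.
move=> k; rewrite /geometric /= /C /r -expRM_natr -expRD ler_expR.
have H1 : lnS k <= d * k.+1%:R + `|ln d|.
  have : ln (d * k.+1%:R) <= d * k.+1%:R.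
    by apply: ltW; apply: ln_sublinear; rewrite mulr_gt0// ltr0n.
  rewrite lnM ?posrE ?ltr0n// -/(lnS k) => h.
  have := ler_norm (- ln d); rewrite normrN; lra.
have H2 : q * lnS k <= `|q| * lnS k by rewrite ler_wpM2r ?lnS_ge0 ?ler_norm.
have H3 : `|q| * lnS k <= `|q| * (d * k.+1%:R + `|ln d|) by rewrite ler_wpM2l.
have H4 : `|q| * d <= t * ln 2 / 2.
  rewrite /d mulrCA ler_pM2l ?mulr_gt0// invfM mulrCA -[leRHS]mulr1.
  by rewrite ler_pM2l// ler_pdivrMr// mul1r lerDl.
have H5 : `|q| * d * k.+1%:R <= t * ln 2 / 2 * k.+1%:R by rewrite ler_wpM2r.
have H6 : 0 <= t * ln 2 by rewrite mulr_ge0 ?ltW.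
have H7 : 0 <= (k%:R : R) by [].
rewrite -natr1 in H1 H3 H5 *.
nra.
Qed.

Lemma sumsL b t q : 0 < t -> sums (fun k => lnS k ^+ b * wt t q k) (L b t q).
Proof.
move=> t0; apply: (sums_dominated _ _ (wt_summable (q + b%:R) t0)) => k.
  exact: Lterm_ge0.
by rewrite -wt_exp ler_wpM2r ?wt_ge0// lnSX_le.
Qed.

Lemma sumsL0 t q : 0 < t -> sums (wt t q) (L 0 t q).
Proof. by move=> t0; apply: eq_sums (sumsL 0 q t0) => k; rewrite expr0 mul1r. Qed.

Lemma L0_ge_term t q k : 0 < t -> wt t q k <= L 0 t q.
Proof. by move=> t0; apply: sums_term (sumsL0 q t0) => *; exact: wt_ge0. Qed.

Lemma L0_gt0 t q : 0 < t -> 0 < L 0 t q.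
Proof. by move=> t0; apply: lt_le_trans (L0_ge_term q 0 t0); exact: wt_gt0. Qed.

Lemma L1_ge_term t q k : 0 < t -> lnS k * wt t q k <= L 1 t q.
Proof.
by move=> t0; apply: (sums_term k _ (sumsL 1 q t0)) => i; exact: Lterm_ge0.
Qed.

(** Put u = y - x. From 1 + v <= exp v at v = u and v = -u one gets exp u - 1 - u <= u (exp u - 1),
    which is at most u^2 exp u for u >= 0 and at most u^2 for u < 0. *)
Lemma expR_quadratic (x y M : R) : expR x <= M -> expR y <= M ->
  `|expR y - expR x - (y - x) * expR x| <= (y - x) ^+ 2 * M.
Proof.
move=> xM yM; set u := y - x.
have yE : expR y = expR x * expR u by rewrite -expRD; congr expR; rewrite /u; ring.
have h1 := expR_ge1Dx u; have h2 := expR_ge1Dx (- u).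
have ex := expR_gt0 x; have eu := expR_gt0 u.
have h3 : expR u * expR (- u) = 1 by rewrite expRxMexpNx_1.
have h4 : expR u - 1 <= u * expR u by nra.
have -> : expR y - expR x - u * expR x = expR x * (expR u - 1 - u) by rewrite yE; ring.
have h6 : 0 <= expR u - 1 - u by lra.
rewrite normrM (ger0_norm (ltW ex)) (ger0_norm h6).
rewrite yE in yM.
have h5 : expR u - 1 - u <= u * (expR u - 1) by lra.
have u2 := sqr_ge0 u.
case: (lerP 0 u) => u0.
  have : expR u - 1 - u <= u ^+ 2 * expR u by nra.
  move=> h; apply: (@le_trans _ _ (expR x * (u ^+ 2 * expR u))); first by rewrite ler_pM2l.
  by rewrite mulrCA; apply: ler_wpM2l.
have : expR u - 1 - u <= u ^+ 2 by nra.
move=> h; apply: (@le_trans _ _ (expR x * (u ^+ 2))); first by rewrite ler_pM2l.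
by rewrite mulrC; apply: ler_wpM2l.
Qed.

Lemma L_quadratic b t q : 0 < t -> exists2 K : R, 0 <= K & forall t' q' : R,
  `|t' - t| <= t / 2 -> `|q' - q| <= 1 ->
  `|L b t' q' - L b t q + ln 2 * L b t (q + 1) * (t' - t) - L b.+1 t q * (q' - q)|
    <= K * (`|t' - t| + `|q' - q|) ^+ 2.
Proof.
move=> t0; have t20 : 0 < t / 2 by lra.
have l2 := ln2_gt0; have l21 := ln2_le1.
(* The weight at t/2 and q + 1 dominates every weight in the box. The shift b + 2 pays for the b
   logarithms and for the squared change of the exponent, at most (k+1)^2 (|t'-t| + |q'-q|)^2. *)
exists (L 0 (t / 2) (q + 1 + (b + 2)%:R)); first exact/ltW/L0_gt0.
move=> t' q' tt qq.
have t'0 : 0 < t' by move: tt; rewrite ler_norml => /andP[]; lra.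
set r : R := `|t' - t| + `|q' - q|.
have s1 := sumsD (sumsB (sumsL b q' t'0) (sumsL b q t0))
  (sumsZ (ln 2 * (t' - t)) (sumsL b (q + 1) t0)).
have s2 := sumsB s1 (sumsZ (q' - q) (sumsL b.+1 q t0)).
have s3 := sumsZ (r ^+ 2) (sumsL0 (q + 1 + (b + 2)%:R) t20).
rewrite [X in `|X|](_ : _ = L b t' q' - L b t q + ln 2 * (t' - t) * L b t (q + 1)
  - (q' - q) * L b.+1 t q); last by ring.
rewrite [leRHS]mulrC; apply: ler_norm_sums s2 s3 => k /=.
set x := q * lnS k - k.+1%:R * (t * ln 2).
set y := q' * lnS k - k.+1%:R * (t' * ln 2).
rewrite [X in `|X|](_ : _ = lnS k ^+ b * (expR y - expR x - (y - x) * expR x)); last first.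
  have -> : wt t (q + 1) k = k.+1%:R * wt t q k.
    by rewrite -[k.+1%:R]expr1 wt_exp.
  have -> : y - x = (q' - q) * lnS k - k.+1%:R * ln 2 * (t' - t) by rewrite /x /y; ring.
  rewrite /wt -/x -/y exprS; move: (expR x) (expR y) => ex ey; ring.
have xM : expR x <= wt (t / 2) (q + 1) k by apply: le_wt; lra.
have yM : expR y <= wt (t / 2) (q + 1) k.
  by apply: le_wt; move: tt qq; rewrite !ler_norml => /andP[+ +] /andP[]; lra.
rewrite normrM ger0_norm ?exprn_ge0 ?lnS_ge0//.
apply: (@le_trans _ _ (k.+1%:R ^+ b * ((k.+1%:R * r) ^+ 2 * wt (t / 2) (q + 1) k))).
  apply: ler_pM => //; first by rewrite exprn_ge0 ?lnS_ge0.
    exact: lnSX_le.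
  apply: le_trans (expR_quadratic xM yM) _.
  rewrite ler_wpM2r ?wt_ge0// -(real_normK (num_real (y - x))) lerXn2r ?nnegrE//.
    by rewrite mulr_ge0 // addr_ge0.
  have -> : y - x = (q' - q) * lnS k - k.+1%:R * ln 2 * (t' - t) by rewrite /x /y; ring.
  apply: le_trans (ler_normB _ _) _.
  rewrite !normrM (ger0_norm (lnS_ge0 k)) (ger0_norm (ltW l2)) (ger0_norm (ler0n _ _)).
  rewrite /r mulrDr addrC lerD//.
    by rewrite -mulrA ler_wpM2l// -[leRHS]mul1r ler_wpM2r.
  by rewrite mulrC ler_wpM2r// lnS_le.
by rewrite -wt_exp exprD exprMn le_eqVlt; apply/orP; left; apply/eqP; ring.
Qed.

Lemma wt_tilt t q d k : wt t (q + d) k = expR (d * lnS k) * wt t q k.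
Proof. by rewrite /wt -expRD; congr expR; ring. Qed.

(** The bound 1 + u <= exp u at u = (q' - q)(ln(k+1) - xi), summed against the weights. It is strict
    for q' != q because ln 1 and ln 2 cannot both equal xi. *)
Lemma L0_tangent t q q' xi : 0 < t ->
  expR ((q' - q) * xi) * (L 0 t q + (q' - q) * (L 1 t q - xi * L 0 t q)) <= L 0 t q'
  ?= iff (q == q').
Proof.
move=> t0.
have s0 := sumsL0 q t0.
have s1 : sums (fun k => lnS k * wt t q k) (L 1 t q) by exact: (sumsL 1 q t0).
have s2 := sumsZ (expR ((q' - q) * xi))
  (sumsD s0 (sumsZ (q' - q) (sumsB s1 (sumsZ xi s0)))).
have s3 := sumsL0 q' t0.
have E k : wt t q' k = expR ((q' - q) * xi) * (expR ((q' - q) * (lnS k - xi)) * wt t q k).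
  by rewrite /wt -!expRD; congr expR; ring.
have E2 k : expR ((q' - q) * xi) * (wt t q k + (q' - q) * (lnS k * wt t q k - xi * wt t q k))
  = expR ((q' - q) * xi) * ((1 + (q' - q) * (lnS k - xi)) * wt t q k) by ring.
apply/leifP; case: eqP => [<-|/eqP qq].
  by rewrite subrr !mul0r addr0 expR0 mul1r.
have [n nx] : exists n, lnS n != xi.
  case: (eqVneq (lnS 0) xi) => [h|]; last by exists 0%N.
  exists 1%N; rewrite -h /lnS ln1; exact/lt0r_neq0/ln2_gt0.
apply: (ltr_sums (n := n) _ _ s2 s3) => [k|] /=; rewrite E E2.
  by rewrite ler_pM2l ?expR_gt0// ler_pM2r ?wt_gt0// expR_ge1Dx.
rewrite ltr_pM2l ?expR_gt0// ltr_pM2r ?wt_gt0// expR_gt1Dx//.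
by rewrite mulf_neq0// subr_eq0// eq_sym.
Qed.

(** The sum of (ln(k+1) - xi)^2 against the weights; it keeps the determinant of the linearised
    system away from zero. *)
Lemma L_variance_gt0 t q xi : 0 < t -> 0 < L 2 t q - 2 * xi * L 1 t q + xi ^+ 2 * L 0 t q.
Proof.
move=> t0.
have s := sumsD (sumsB (sumsL 2 q t0) (sumsZ (2 * xi) (sumsL 1 q t0))) (sumsZ (xi ^+ 2) (sumsL0 q t0)).
have E k : lnS k ^+ 2 * wt t q k - 2 * xi * (lnS k ^+ 1 * wt t q k) + xi ^+ 2 * wt t q k =
  (lnS k - xi) ^+ 2 * wt t q k by ring.
have [n nx] : exists n, lnS n != xi.
  case: (eqVneq (lnS 0) xi) => [h|]; last by exists 0%N.
  exists 1%N; rewrite -h /lnS ln1; exact/lt0r_neq0/ln2_gt0.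
apply: (sums_gt0 (n := n) _ _ s) => [k|] /=; rewrite E.
  by rewrite mulr_ge0 ?sqr_ge0 ?wt_ge0.
by rewrite mulr_gt0 ?wt_gt0// exprn_even_gt0//= subr_eq0.
Qed.

(** Every digit is at least 1, so each term gains at least the factor 2^(t' - t). *)
Lemma L0_decr t t' q : 0 < t -> t <= t' -> expR ((t' - t) * ln 2) * L 0 t' q <= L 0 t q.
Proof.
move=> t0 tt; have t'0 : 0 < t' by exact: lt_le_trans tt.
apply: ler_sums (sumsZ _ (sumsL0 q t'0)) (sumsL0 q t0) => k.
have kE : k.+1%:R = k%:R + 1 :> R by rewrite natr1.
rewrite /wt -expRD ler_expR kE.
have l2 := ln2_gt0; have k0 : 0 <= (k%:R : R) by [].
have : 0 <= k%:R * ((t' - t) * ln 2).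
  by apply: mulr_ge0 => //; apply: mulr_ge0; [rewrite subr_ge0|exact: ltW].
nra.
Qed.

Lemma L0_lt t t' q : 0 < t -> t < t' -> L 0 t' q < L 0 t q.
Proof.
move=> t0 tt; apply: lt_le_trans (L0_decr q t0 (ltW tt)).
rewrite -[ltLHS]mul1r ltr_pM2r ?L0_gt0//; last exact: lt_trans tt.
by rewrite expR_gt1 mulr_gt0 ?subr_gt0 ?ln2_gt0.
Qed.

Lemma L0_le t t' q : 0 < t -> t <= t' -> L 0 t' q <= L 0 t q.
Proof.
by move=> t0; rewrite le_eqVlt => /predU1P[->//|tt]; exact/ltW/L0_lt.
Qed.

End WeightedSeries.

(** * The tangency system: uniqueness and existence *)

Section Solutions.
Variable R : realType.
Implicit Types (t q xi : R) (b k n : nat).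

Lemma L_lipschitz b t q : 0 < t -> exists2 M : R, 0 < M & forall t' q',
  `|t' - t| <= t / 2 -> `|q' - q| <= 1 ->
  `|L b t' q' - L b t q| <= M * (`|t' - t| + `|q' - q|).
Proof.
move=> t0; have [K K0 HK] := L_quadratic b q t0.
exists (K * (t / 2 + 1) + `|ln 2 * L b t (q + 1)| + `|L b.+1 t q| + 1) => [|t' q' tt qq].
  by rewrite ltr_wpDl// !addr_ge0// mulr_ge0// addr_ge0//; lra.
have := HK _ _ tt qq.
set r : R := `|t' - t| + `|q' - q| => H.
have r0 : 0 <= r by rewrite addr_ge0.
rewrite -[X in `|X|](_ : (L b t' q' - L b t q + ln 2 * L b t (q + 1) * (t' - t) -
  L b.+1 t q * (q' - q)) - ln 2 * L b t (q + 1) * (t' - t) + L b.+1 t q * (q' - q) = _);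
  last by ring.
apply: le_trans (ler_normD _ _) _; rewrite normrM.
have h1 : `|L b.+1 t q| * `|q' - q| <= `|L b.+1 t q| * r by rewrite ler_wpM2l// lerDr.
have : `|(L b t' q' - L b t q + ln 2 * L b t (q + 1) * (t' - t) -
  L b.+1 t q * (q' - q)) - ln 2 * L b t (q + 1) * (t' - t)| <=
  K * (t / 2 + 1) * r + `|ln 2 * L b t (q + 1)| * r.
  apply: le_trans (ler_normB _ _) _; apply: lerD.
    apply: le_trans H _; rewrite expr2 mulrA ler_wpM2r// ler_wpM2l// /r; lra.
  by rewrite normrM ler_wpM2l// lerDl.
move: (`|_ - _|); move: (`|ln 2 * _|); move: h1; move: `|L b.+1 t q|; move: `|q' - q|; move=> *; lra.
Qed.

Lemma L_cvg b t q (T : Type) (F : set_system T) (FF : Filter F) (f g : T -> R) : 0 < t ->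
  f @ F --> t -> g @ F --> q -> L b (f x) (g x) @[x --> F] --> L b t q.
Proof.
move=> t0 ft gq; have [M M0 HM] := L_lipschitz b q t0.
apply/cvgrPdist_le => e e0.
have t20 : 0 < t / 2 by lra.
have eM : 0 < e / (2 * M) by rewrite divr_gt0// mulr_gt0.
near=> x; rewrite distrC.
have h1 : `|f x - t| <= t / 2.
  by rewrite distrC; near: x; exact: (cvgr_dist_le _ _ ft).
have h2 : `|g x - q| <= 1.
  by rewrite distrC; near: x; exact: (cvgr_dist_le _ _ gq).
have h3 : `|f x - t| <= e / (2 * M).
  by rewrite distrC; near: x; exact: (cvgr_dist_le _ _ ft).
have h4 : `|g x - q| <= e / (2 * M).
  by rewrite distrC; near: x; exact: (cvgr_dist_le _ _ gq).
apply: le_trans (HM _ _ h1 h2) _.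
have -> : e = M * (e / (2 * M) + e / (2 * M)) by field; exact: lt0r_neq0.
by apply: ler_wpM2l; [exact: ltW|exact: lerD].
Unshelve. all: by end_near. Qed.

(** The pressure system cleared of logarithms and derivatives; [solves_pressure] gives the
    equivalence. *)
Definition solves xi t q := L 0 t q = expR (q * xi) /\ L 1 t q = xi * L 0 t q.

Lemma solves_min xi t q q' : 0 < t -> solves xi t q ->
  expR (q' * xi) <= L 0 t q' ?= iff (q == q').
Proof.
move=> t0 [h0 h1]; have := L0_tangent q q' xi t0.
by rewrite h1 subrr mulr0 addr0 h0 -expRD -mulrDl subrK.
Qed.

(** Upper bounds on t(xi) reduce to one q' at which the curve of level s dips below the line: for s
    <= t, monotonicity in t would keep it above. *)
Lemma solves_lt xi t q s q' : 0 < t -> 0 < s -> solves xi t q ->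
  L 0 s q' < expR (q' * xi) -> t < s.
Proof.
move=> t0 s0 h; apply: contraTT; rewrite -!leNgt => st.
exact: le_trans (solves_min q' t0 h).1 (L0_le q' s0 st).
Qed.

Lemma solves_unique xi t q t' q' : 0 < t -> 0 < t' -> solves xi t q -> solves xi t' q' ->
  t = t' /\ q = q'.
Proof.
move=> t0 t'0 h h'.
have aux (u p u' p' : R) : 0 < u -> 0 < u' -> solves xi u p -> solves xi u' p' -> u <= u'.
  move=> u0 u'0 k k'; rewrite leNgt; apply/negP => uu.
  have := L0_lt p' u'0 uu; rewrite (proj1 k') ltNge.
  by rewrite (solves_min p' u0 k).1.
have tt : t = t' by apply/eqP; rewrite eq_le (aux _ _ _ _ _ _ h h')//= (aux _ _ _ _ _ _ h' h).
subst t'; split=> //; apply/eqP.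
by have [_ <-] := solves_min q' t0 h; rewrite (proj1 h') eqxx.
Qed.

(** For q >= 0 compare with a term having ln(k+1) >= c + 1, for q < 0 with the term of digit 1.
    Uniformity in xi serves the continuity of the solution curve. *)
Lemma q_linear_growth (a c : R) : 0 < a -> exists2 C : R, 0 < C & forall xi t q,
  a <= xi <= c -> 0 < t -> L 0 t q <= expR (q * xi) -> `|q| <= C * t.
Proof.
move=> a0; have l2 := ln2_gt0 R; have l21 := ln2_le1 R.
pose k := Num.bound (expR (c + 1)).
have kc : c + 1 <= lnS R k.
  rewrite -ler_expR expR_lnS.
  have := archi_boundP (expR_ge0 (c + 1)); rewrite -/k => /ltW h.
  by apply: le_trans h _; rewrite ler_nat.
have k0 : 0 < k.+1%:R :> R by [].
exists (k.+1%:R + a^-1) => [|xi t q /andP[axi xic] t0 h].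
  by rewrite addr_gt0 ?invr_gt0.
have a'0 : 0 < a^-1 by rewrite invr_gt0.
have xi0 : 0 < xi by exact: lt_le_trans axi.
case: (lerP 0 q) => q0.
  have := le_trans (L0_ge_term q k t0) h; rewrite /wt ler_expR.
  have h1 : q * (c + 1) <= q * lnS R k by rewrite ler_wpM2l.
  have h2 : q * xi <= q * c by rewrite ler_wpM2l.
  have h3 : k.+1%:R * (t * ln 2) <= k.+1%:R * t.
    by rewrite ler_wpM2l// -[leRHS]mulr1 ler_wpM2l// ltW.
  have h4 : 0 < a^-1 * t by rewrite mulr_gt0.
  rewrite ger0_norm//; lra.
have := le_trans (L0_ge_term q 0 t0) h; rewrite /wt ler_expR /lnS ln1 mulr0 mul1r sub0r.
have h1 : q * xi <= q * a by rewrite ler_wnM2l// ltW.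
have h2 : t * ln 2 <= t by rewrite -[leRHS]mulr1 ler_wpM2l// ltW.
move=> h3; have h4 : - q * a <= t by lra.
have h5 : - q <= t / a by rewrite ler_pdivlMr.
have h6 : 0 <= k.+1%:R * t by rewrite mulr_ge0// ltW.
rewrite ltr0_norm//; lra.
Qed.

(** If t is small, so is q by the linear bound; then the terms of digits 1 and 2 are both near 1,
    and their sum exceeds exp(q xi), which is near 1 as well. *)
Lemma t_lower_bound xi : 0 < xi -> exists2 t1, 0 < t1 & forall t q,
  0 < t -> L 0 t q <= expR (q * xi) -> t1 <= t.
Proof.
move=> xi0; have [C C0 HC] := q_linear_growth xi xi0.
have l2 := ln2_gt0 R; have l21 := ln2_le1 R.
have D0 : 0 < 2 + C + C * xi by rewrite !addr_gt0// mulr_gt0.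
exists (ln 2 / (2 + C + C * xi)) => [|t q t0 h]; first by rewrite divr_gt0.
have qC : `|q| <= C * t by apply: (HC xi) => //; rewrite lexx.
have [q1 q2] : - (C * t) <= q /\ q <= C * t by move: qC; rewrite ler_norml => /andP.
rewrite ler_pdivrMr//.
have := le_trans (sums_partial 2 (fun k => wt_ge0 t q k) (sumsL0 q t0)) h.
rewrite !big_ord_recr big_ord0/= add0r.
have tl : t * ln 2 <= t by rewrite -[leRHS]mulr1 ler_wpM2l// ltW.
have tl0 : 0 < t * ln 2 by rewrite mulr_gt0.
have Ct : 0 < C * t by rewrite mulr_gt0.
have w0 : expR (- ((2 + C) * t)) <= wt t q 0.
  by rewrite /wt ler_expR /lnS ln1 mulr0 mul1r; lra.
have w1 : expR (- ((2 + C) * t)) <= wt t q 1.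
  rewrite /wt ler_expR /lnS.
  have : - (C * t) * ln 2 <= q * ln 2 by rewrite ler_wpM2r// ltW.
  have : C * t * ln 2 <= C * t by rewrite -[leRHS]mulr1 ler_wpM2l// ltW.
  lra.
have e2 : expR (q * xi) <= expR (C * t * xi) by rewrite ler_expR ler_wpM2r// ltW.
move=> h2.
have : expR (ln 2 - (2 + C) * t) <= expR (C * t * xi).
  apply: le_trans e2; apply: le_trans h2.
  by rewrite expRD lnK ?posrE//; lra.
by rewrite ler_expR; lra.
Qed.

(** First-order condition at a minimum. The test increment -D / (|D| + K + 1) has size at most 1 and
    is small enough for the linear term to win. *)
Lemma linear_dominated_by_square (D K : R) : 0 <= K ->
  (forall h, `|h| <= 1 -> 0 <= h * D + K * h ^+ 2) -> D = 0.
Proof.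
move=> K0 H; apply/eqP/negP => /negP D0.
have nD : 0 < `|D| by rewrite normr_gt0.
have s0 : 0 < `|D| + K + 1 by lra.
pose s := (`|D| + K + 1)^-1.
have sp : 0 < s by rewrite invr_gt0.
have sE : s * (`|D| + K + 1) = 1 by rewrite mulVf// lt0r_neq0.
have := H (- D * s); rewrite normrM normrN (ger0_norm (ltW sp)).
have -> : `|D| * s <= 1 by nra.
move=> /(_ isT).
have DD : 0 < D ^+ 2 * s by rewrite mulr_gt0// exprn_even_gt0.
have -> : - D * s * D + K * (- D * s) ^+ 2 = - (D ^+ 2 * s) * (1 - K * s) by ring.
have : 0 < 1 - K * s by nra.
nra.
Qed.

Lemma L0_1_0 : L 0 1 0 = 1 :> R.
Proof.
apply: (sums_unique (sumsL0 0 ltr01)); split.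
have := @cvg_geometric_series R 2^-1 2^-1.
rewrite (_ : 2^-1 / (1 - 2^-1) = 1 :> R); last by field.
rewrite (_ : geometric _ _ = wt 1 0).
  by apply; rewrite ger0_norm; lra.
apply/funext => k; rewrite /geometric /= /wt mul0r sub0r mul1r expRN expRM_natl.
by rewrite lnK ?posrE// -exprS -exprVn.
Qed.

Lemma solves_exists xi : 0 < xi -> exists t q, [/\ 0 < t, t <= 1 & solves xi t q].
Proof.
move=> xi0.
have [C C0 HC] := q_linear_growth xi xi0.
have [t1 t10 Ht1] := t_lower_bound xi0.
have L01 := L0_1_0.
pose box := `[t1, 1] `*` `[- C, C] : set (R * R).
(* [L] is controlled only for positive t; [Num.max] makes [G] continuous everywhere and changes
   nothing on the box. *)
pose G (p : R * R) := L 0 (Num.max p.1 t1) p.2 - expR (p.2 * xi).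
have Gc : continuous G.
  move=> p; apply: cvgB.
    apply: L_cvg; first by rewrite lt_max t10 orbT.
      apply: (@continuous_max _ _ (fun p : R * R => p.1) (fun=> t1)); [exact: cvg_fst | exact: cvg_cst].
    exact: cvg_snd.
  apply: (@continuous_comp _ _ _ (fun p : R * R => p.2 * xi) expR).
    by apply: cvgMl; exact: cvg_snd.
  exact: continuous_expR.
pose A := box `&` [set p | G p <= 0].
have Acl : closed [set p | G p <= 0].
  have := closed_comp (f := G) (D := [set x : R | x <= 0]).
  by apply; [move=> x _; exact: Gc | exact: closed_le].
have Aco : compact A.
  have bc : compact box by apply: compact_setX; exact: segment_compact.
  apply: (subclosed_compact _ bc) => [|p []//].
  by apply: closedI => //; apply: compact_closed.
have t11 : t1 <= 1 by apply: (Ht1 1 0) => //; rewrite L01 mul0r expR0.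
have A0 : A !=set0.
  exists (1, 0); split.
    by split; rewrite /= in_itv/= ?t11 ?lexx//; apply/andP; split; lra.
  by rewrite /G/= max_l// L01 mul0r expR0 subrr.
have [t [q [/andP[t1t tle1] Gtq tmin]]] : exists t q : R, [/\ t1 <= t <= 1, G (t, q) <= 0 &
    forall s p : R, A (s, p) -> t <= s].
  have [|[t q] /set_mem[[/= tb _] /= Gtq] tmin] :=
    @compact_EVT_min _ R (fun p : R * R => p.1) A A0 Aco.
    by apply: continuous_subspaceT => p; exact: cvg_fst.
  exists t, q; split=> [||s p Asp]; [by move: tb; rewrite in_itv|by []|].
  by apply: (tmin (s, p)); exact/mem_set.
have t0 : 0 < t by exact: lt_le_trans t1t.
(* A pair on or below the line at a level s < t would satisfy the a priori bounds, hence lie in the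
   box and contradict minimality. *)
have HA s p : 0 < s -> s < t -> expR (p * xi) < L 0 s p.
  move=> s0 st; rewrite ltNge; apply/negP => h.
  have ps := HC xi s p; rewrite lexx /= in ps; have := ps isT s0 h.
  have sle1 : s <= 1 by lra.
  have Cs : C * s <= C by rewrite -[leRHS]mulr1 ler_pM2l.
  move=> /le_trans/(_ Cs); rewrite ler_norml => pb.
  have t1s := Ht1 _ _ s0 h.
  have : A (s, p).
    split; first by split; rewrite /= in_itv/= ?pb// t1s sle1.
    by rewrite /G /= max_l// subr_le0.
  by move=> /tmin/=; rewrite leNgt st.
(* Let s increase to t; together with [Gtq], the curve of level t lies above the line and touches it
   at q. *)
have HB p : expR (p * xi) <= L 0 t p.
  have cv : L 0 s p @[s --> t^'-] --> L 0 t p.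
    refine (@L_cvg 0 t p _ (t^'-) _ (fun s : R => s) (fun=> p) t0 _ _).
      exact/cvg_at_left_filter/cvg_id.
    exact: cvg_cst.
  rewrite -(cvg_lim _ cv)//; apply: limr_ge; first exact: cvgP cv.
  near=> s; apply/ltW/HA; near: s; [exact: nbhs_left_gt|exact: nbhs_left_lt].
exists t, q; split=> //.
have E0 : L 0 t q = expR (q * xi).
  apply/eqP; rewrite eq_le HB andbT; move: Gtq; rewrite /G/= max_l//.
  by rewrite subr_le0.
split=> //; apply/eqP; rewrite -subr_eq0; apply/eqP.
have [K K0 HK] := L_quadratic 0 q t0.
(* q minimises [L 0 t p - expR (p * xi)] over p, and the derivative there is
   [L 1 t q - xi * L 0 t q]. *)
apply: (linear_dominated_by_square K0) => h h1.
have := HK t (q + h); rewrite subrr normr0 addrAC subrr add0r => H.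
have {}H := H (ltW (divr_gt0 t0 (ltr0Sn _ _))) h1; rewrite mulr0 addr0 add0r real_normK ?num_real// in H.
have := le_trans (ler_norm _) H.
have := HB (q + h); rewrite mulrDl expRD -E0.
have : L 0 t q * (1 + h * xi) <= L 0 t q * expR (h * xi).
  by rewrite ler_pM2l ?L0_gt0// expR_ge1Dx.
lra.
Unshelve. all: by end_near. Qed.

End Solutions.

(** * Factored increments and slopes *)

Section Slopes.
Variable R : realType.
Implicit Types (t q xi : R) (b k n : nat).

(** Carathéodory's form of the derivative: increments factor exactly, so linear equations between
    them can be solved without dividing by y - x. *)
Definition has_slope (f : R -> R) (x l : R) := exists2 D : R -> R,
  (\forall y \near x, f y - f x = (y - x) * D y) & D y @[y --> x] --> l.

Lemma has_slope_derive f x l : has_slope f x l -> is_derive x 1 f l.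
Proof.
move=> [D fD Dl].
suff H : (fun h => h^-1 *: (f (h *: 1 + x) - f x)) @ 0^' --> l.
  apply: DeriveDef; first exact: (cvgP l H).
  exact/cvg_lim.
have shx : (fun h : R => h *: 1 + x) @ 0^' --> x.
  rewrite -[X in _ --> X]add0r; apply: cvgD; last exact: cvg_cst.
  rewrite -[X in _ --> X](scale0r (1 : R)); apply: cvgZr_tmp; apply: cvg_within_filter.
  exact: cvg_id.
have Dh : (fun h : R => D (h *: 1 + x)) @ 0^' --> l by apply: cvg_comp shx Dl.
apply: cvg_trans Dh; apply: near_eq_cvg; near=> h.
have h0 : h != 0 by near: h; exact: nbhs_dnbhs_neq.
have -> : f (h *: 1 + x) - f x = (h *: 1 + x - x) * D (h *: 1 + x).
  by near: h; exact: (shx _ fD).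
by rewrite addrK /GRing.scale /= mulr1 mulKf.
Unshelve. all: by end_near. Qed.

(** Carathéodory's form in two variables, along any filter. The quadratic remainder is shared
    between the two factors in proportion to |t'-t| and |q'-q|, using |x| = sg(x) x. *)
Lemma L_increment b t q : 0 < t -> exists A B : R -> R -> R,
  (forall t' q', `|t' - t| <= t / 2 -> `|q' - q| <= 1 ->
    L b t' q' - L b t q = A t' q' * (t' - t) + B t' q' * (q' - q)) /\
  (forall (T : Type) (F : set_system T) (FF : Filter F) (f g : T -> R),
    f @ F --> t -> g @ F --> q ->
    A (f x) (g x) @[x --> F] --> - (ln 2 * L b t (q + 1)) /\
    B (f x) (g x) @[x --> F] --> L b.+1 t q).
Proof.
move=> t0; have [K K0 HK] := L_quadratic b q t0.
set a := ln 2 * L b t (q + 1); set c := L b.+1 t q.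
pose rem t' q' := L b t' q' - L b t q + a * (t' - t) - c * (q' - q).
pose r (t' q' : R) : R := `|t' - t| + `|q' - q|.
have r0 t' q' : 0 <= r t' q' by rewrite addr_ge0.
exists (fun t' q' => - a + rem t' q' / r t' q' * Num.sg (t' - t)).
exists (fun t' q' => c + rem t' q' / r t' q' * Num.sg (q' - q)).
have remle t' q' : `|t' - t| <= t / 2 -> `|q' - q| <= 1 ->
    `|rem t' q' / r t' q'| <= K * r t' q'.
  move=> tt qq; rewrite normrM normfV (ger0_norm (r0 _ _)).
  have := HK t' q' tt qq; rewrite -/a -/c -/(rem t' q') -/(r t' q') => H.
  case: (eqVneq (r t' q') 0) => [->|rn]; first by rewrite invr0 !mulr0.
  rewrite ler_pdivrMr; last by rewrite lt_def rn r0.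
  by rewrite -mulrA -expr2.
split=> [t' q' tt qq|T F FF f g ft gq].
  case: (eqVneq (r t' q') 0) => [rE|rn].
    move/eqP: rE; rewrite paddr_eq0// !normr_eq0 !subr_eq0 => /andP[/eqP-> /eqP->].
    by rewrite !subrr !mulr0 addr0.
  rewrite -[LHS](_ : rem t' q' / r t' q' * r t' q' - a * (t' - t) + c * (q' - q) = _); last first.
    by rewrite divfK// /rem; ring.
  rewrite /r -(mulr_sg_norm (t' - t)) -(mulr_sg_norm (q' - q)).
  rewrite /r !normrEsg; ring.
have rF : r (f x) (g x) @[x --> F] --> 0.
  rewrite -[X in _ --> X](addr0 0); apply: cvgD.
    by rewrite -(@normr0 _ R) -(subrr t); apply: cvg_norm; apply: cvgB => //; exact: cvg_cst.
  by rewrite -(@normr0 _ R) -(subrr q); apply: cvg_norm; apply: cvgB => //; exact: cvg_cst.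
have remF (s : T -> R) : (forall x, `|s x| <= 1) ->
    rem (f x) (g x) / r (f x) (g x) * s x @[x --> F] --> 0.
  move=> s1; have KrF : K * r (f x) (g x) @[x --> F] --> 0.
    by rewrite -[X in _ --> X](mulr0 K); apply: cvgMr.
  apply/cvgr0Pnorm_le => e e0; near=> x.
  apply: (@le_trans _ _ (K * r (f x) (g x))).
    rewrite normrM -[leRHS]mulr1; apply: ler_pM => //; apply: remle.
      by rewrite distrC; near: x; apply: (cvgr_dist_le _ _ ft); lra.
    by rewrite distrC; near: x; apply: (cvgr_dist_le _ _ gq).
  apply: le_trans (ler_norm _) _.
  by near: x; move/cvgr0Pnorm_le: KrF; apply.
have sg1 (x : R) : `|Num.sg x| <= 1 by rewrite normr_sg; case: (x != 0).
split.
  by rewrite -[X in _ --> X]addr0; apply: cvgD; [exact: cvg_cst|exact: remF].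
by rewrite -[X in _ --> X]addr0; apply: cvgD; [exact: cvg_cst|exact: remF].
Unshelve. all: by end_near. Qed.

Lemma expR_increment (x : R) : exists2 E : R -> R,
  (forall y, expR y - expR x = E y * (y - x)) &
  forall (T : Type) (F : set_system T) (FF : Filter F) (f : T -> R),
    f @ F --> x -> E (f z) @[z --> F] --> expR x.
Proof.
pose E y := if y == x then expR x else (expR y - expR x) / (y - x).
exists E => [y|T F FF f fx].
  rewrite /E; case: eqVneq => [->|yx]; first by rewrite !subrr mulr0.
  by rewrite divfK// subr_eq0.
have EL y : `|y - x| <= 1 -> `|E y - expR x| <= `|y - x| * expR (x + 1).
  rewrite /E; case: eqVneq => [->|yx] y1; first by rewrite !subrr normr0 mul0r.
  have yx0 : y - x != 0 by rewrite subr_eq0.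
  have ny : 0 < `|y - x| by rewrite normr_gt0.
  have := @expR_quadratic R x y (expR (x + 1)); rewrite !ler_expR lerDl ler01 => /(_ isT).
  have -> : y <= x + 1 by move: y1; rewrite ler_norml => /andP[_]; lra.
  move=> /(_ isT) H.
  rewrite -(ler_pM2l ny) -normrM mulrA -expr2 real_normK ?num_real//.
  by rewrite mulrBr mulrCA divff// mulr1.
have fxF : `|f z - x| * expR (x + 1) @[z --> F] --> 0.
  rewrite -[X in _ --> X](mul0r (expR (x + 1))); apply: cvgMl.
  by rewrite -(@normr0 _ R) -(subrr x); apply: cvg_norm; apply: cvgB => //; exact: cvg_cst.
apply/cvgrPdist_le => e e0; near=> z; rewrite distrC.
apply: (@le_trans _ _ (`|f z - x| * expR (x + 1))).
  by apply: EL; rewrite distrC; near: z; apply: (cvgr_dist_le _ _ fx).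
apply: le_trans (ler_norm _) _.
by near: z; move/cvgr0Pnorm_le: fxF; apply.
Unshelve. all: by end_near. Qed.

(** The tangent inequalities at q and at q' are both strict, and chaining them cancels the
    exponential factors. *)
Lemma mean_increasing t q q' xi : 0 < t -> q != q' -> L 1 t q = xi * L 0 t q ->
  0 < (q' - q) * (L 1 t q' - xi * L 0 t q').
Proof.
move=> t0 qq h.
have := lt_leif (L0_tangent q q' xi t0); rewrite qq h subrr mulr0 addr0 => h1.
have := lt_leif (L0_tangent q' q xi t0); rewrite eq_sym qq => h2.
set D := L 1 t q' - _ in h2 *.
have E : expR ((q' - q) * xi) * expR ((q - q') * xi) = 1.
  by rewrite -expRD -mulrDl (_ : q' - q + (q - q') = 0) ?mul0r ?expR0//; ring.
have : expR ((q' - q) * xi) * (expR ((q - q') * xi) * (L 0 t q' + (q - q') * D))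
   < expR ((q' - q) * xi) * L 0 t q by rewrite ltr_pM2l ?expR_gt0.
rewrite mulrA E mul1r => /lt_trans/(_ h1); lra.
Qed.

End Slopes.

(** * The solution curve and its derivatives *)

Section ImplicitFunctions.
Variables (R : realType) (tf qf : R -> R).
Hypothesis tqP : forall xi, 0 < xi ->
  [/\ 0 < tf xi, tf xi <= 1 & solves xi (tf xi) (qf xi)].
Implicit Types (xi : R).

Lemma tf_gt0 xi : 0 < xi -> 0 < tf xi. Proof. by move=> /tqP[]. Qed.

Lemma near_dist_lt (x e : R) : 0 < e -> \forall y \near x, `|x - y| < e.
Proof.
move=> e0; have h : (fun y : R => y) @ x --> x by exact: cvg_id.
exact: (cvgr_dist_lt _ _ h).
Qed.

Lemma near_pos xi : 0 < xi -> \forall y \near xi, 0 < y.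
Proof. by move=> xi0; exact: lt_nbhsr. Qed.

Lemma tf_cvg xi : 0 < xi -> tf @ xi --> tf xi.
Proof.
move=> xi0; have [t0 t1 s] := tqP xi0.
have l2 := ln2_gt0 R.
have [C C0 HC] := q_linear_growth (2 * xi) (divr_gt0 xi0 (ltr0Sn _ 1)).
apply/cvgrPdist_lt => e e0; near=> y.
have y0 : 0 < y by near: y; exact: near_pos.
have [t'0 t'1 s'] := tqP y0.
(* The inequality is strict at y = xi, persists nearby, and bounds t(y) through [solves_lt]. *)
have h : L 0 (tf xi + e) (qf xi) < expR (qf xi * y).
  near: y; apply: (cvgr_gt (expR (qf xi * xi))).
    apply: (@continuous_comp _ _ _ (fun y => qf xi * y) expR); last exact: continuous_expR.
    by apply: cvgMr; exact: cvg_id.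
  by rewrite -(proj1 s); apply: L0_lt => //; rewrite ltrDl.
have up : tf y < tf xi + e by apply: (solves_lt t'0 _ s' h); exact: addr_gt0.
rewrite ltr_norml; apply/andP; split; first by clear - up; lra.
case: (lerP (tf xi) (tf y)) => tt; first by clear - tt e0; lra.
(* If t(y) < t(xi), then 2^(t(xi) - t(y)) exp(q(y) xi) <= exp(q(y) y); the drop is at most |q(y)| |y
   - xi| / ln 2, and q(y) is bounded near xi. *)
have := L0_decr (qf y) t'0 (ltW tt); rewrite (proj1 s') => h2.
have h3 := (solves_min (qf y) t0 s).1.
have : expR ((tf xi - tf y) * ln 2) * expR (qf y * xi) <= expR (qf y * y).
  by apply: le_trans h2; rewrite ler_pM2l ?expR_gt0.
rewrite -expRD ler_expR => h4.
have qC : `|qf y| <= C.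
  apply: (@le_trans _ _ (C * tf y)); last by rewrite -[leRHS]mulr1 ler_pM2l.
  apply: (HC y) => //; last by rewrite (proj1 s').
  have /ltW : `|xi - y| < xi / 2.
    by near: y; apply: near_dist_lt; rewrite divr_gt0.
  by rewrite ler_norml => /andP[h6 h7]; clear - h6 h7; apply/andP; split; lra.
have h5 : `|y - xi| < e * ln 2 / C.
  by rewrite distrC; near: y; apply: near_dist_lt; rewrite divr_gt0// mulr_gt0.
rewrite -(ltr_pM2r l2).
apply: (@le_lt_trans _ _ (qf y * (y - xi))); first by clear - h4; lra.
apply: le_lt_trans (ler_norm _) _; rewrite normrM.
apply: (@le_lt_trans _ _ (C * `|y - xi|)); first by rewrite ler_wpM2r.
by rewrite mulrC -ltr_pdivlMr.
Unshelve. all: by end_near. Qed.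

(** At the level t(xi), [L 1 - xi * L 0] is negative at q - e and positive at q + e. Both signs
    persist for y near xi and trap q(y) by [mean_increasing]. *)
Lemma qf_cvg xi : 0 < xi -> qf @ xi --> qf xi.
Proof.
move=> xi0; have [t0 t1 [s0 s1]] := tqP xi0.
have tc := tf_cvg xi0.
have G (p : R) : L 1 (tf y) p - y * L 0 (tf y) p @[y --> xi] -->
    L 1 (tf xi) p - xi * L 0 (tf xi) p.
  by apply: cvgB; [|apply: cvgM; first exact: cvg_id]; apply: L_cvg => //; exact: cvg_cst.
apply/cvgrPdist_lt => e e0.
have up : 0 < L 1 (tf xi) (qf xi + e) - xi * L 0 (tf xi) (qf xi + e).
  have := @mean_increasing _ (tf xi) (qf xi) (qf xi + e) xi t0 _ s1.
  rewrite addrAC subrr add0r pmulr_rgt0//; apply.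
  by rewrite eq_sym -subr_eq0 addrAC subrr add0r gt_eqF.
have lo : L 1 (tf xi) (qf xi - e) - xi * L 0 (tf xi) (qf xi - e) < 0.
  have := @mean_increasing _ (tf xi) (qf xi) (qf xi - e) xi t0 _ s1.
  rewrite addrAC subrr add0r nmulr_rgt0 ?oppr_lt0//; apply.
  by rewrite eq_sym -subr_eq0 addrAC subrr add0r oppr_eq0 gt_eqF.
near=> y.
have y0 : 0 < y by near: y; exact: near_pos.
have [t'0 t'1 [s0' s1']] := tqP y0.
have up' : 0 < L 1 (tf y) (qf xi + e) - y * L 0 (tf y) (qf xi + e).
  by near: y; exact: (cvgr_gt _ (G _)).
have lo' : L 1 (tf y) (qf xi - e) - y * L 0 (tf y) (qf xi - e) < 0.
  by near: y; exact: (cvgr_lt _ (G _)).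
rewrite ltr_norml; apply/andP; split.
  case: (eqVneq (qf y) (qf xi + e)) => [E|E].
    by move: up'; rewrite -E s1' subrr ltxx.
  by have := mean_increasing t'0 E s1'; rewrite (pmulr_lgt0 _ up') => h; clear - h; lra.
case: (eqVneq (qf y) (qf xi - e)) => [E|E].
  by move: lo'; rewrite -E s1' subrr ltxx.
by have := mean_increasing t'0 E s1'; rewrite (nmulr_lgt0 _ lo') => h; clear - h; lra.
Unshelve. all: by end_near. Qed.

(** The quotient q / (dP/dt), where dP/dt = - ln 2 [L 0 t (q + 1)] / [L 0 t q]. *)
Definition tf' xi := - (qf xi * L 0 (tf xi) (qf xi) / (ln 2 * L 0 (tf xi) (qf xi + 1))).

(** The q'-component of the solution of a0 t' = q L0 and (a1 - xi a0) t' + (L2 - xi L1) q' = L0, the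
    linearised system. *)
Definition qf' xi := let t := tf xi in let q := qf xi in
  let a0 := - (ln 2 * L 0 t (q + 1)) in let a1 := - (ln 2 * L 1 t (q + 1)) in
  (a0 * L 0 t q - (a1 - xi * a0) * (L 0 t q * q)) / (a0 * (L 2 t q - xi * L 1 t q)).

(* Cramer's rule for the increments of [L 0 = expR (q * xi)] and [L 1 = xi * L 0];
   the matrix is triangular in the limit since [L 1 - xi * L 0] vanishes. *)
Lemma tf_qf_slope xi : 0 < xi -> has_slope tf xi (tf' xi) /\ has_slope qf xi (qf' xi).
Proof.
move=> xi0; have [t0 t1 [s0 s1]] := tqP xi0.
set t := tf xi in t0 t1 s0 s1 *; set q := qf xi in s0 s1 *.
have tc := tf_cvg xi0; have qc := qf_cvg xi0.
have l2 := ln2_gt0 R.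
have [A0 [B0 [H0 c0]]] := L_increment 0 q t0.
have [A1 [B1 [H1 c1]]] := L_increment 1 q t0.
have [E HE cE] := expR_increment (q * xi).
have [/(_ _)cA0 cB0] := c0 _ _ _ _ _ tc qc.
have [cA1 cB1] := c1 _ _ _ _ _ tc qc.
have cC : E (qf y * y) @[y --> xi] --> L 0 t q.
  by rewrite s0; apply: cE; apply: cvgM => //; exact: cvg_id.
set a0 := - (ln 2 * L 0 t (q + 1)) in cA0.
set a1 := - (ln 2 * L 1 t (q + 1)) in cA1.
pose a y := A0 (tf y) (qf y).
pose b y := B0 (tf y) (qf y) - E (qf y * y) * y.
pose c y := A1 (tf y) (qf y) - y * A0 (tf y) (qf y).
pose d y := B1 (tf y) (qf y) - y * B0 (tf y) (qf y).
pose e y := E (qf y * y) * q.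
have ca : a y @[y --> xi] --> a0 by exact: cA0.
have cb : b y @[y --> xi] --> (0 : R).
  rewrite -(subrr (L 1 t q)) {2}s1 [xi * _]mulrC.
  by apply: cvgB => //; apply: cvgM => //; exact: cvg_id.
have cc : c y @[y --> xi] --> a1 - xi * a0.
  by apply: cvgB => //; apply: cvgM => //; exact: cvg_id.
have cd : d y @[y --> xi] --> L 2 t q - xi * L 1 t q.
  by apply: cvgB => //; apply: cvgM => //; exact: cvg_id.
have ce : e y @[y --> xi] --> L 0 t q * q by apply: cvgMl.
pose det y := a y * d y - b y * c y.
have cdet : det y @[y --> xi] --> a0 * (L 2 t q - xi * L 1 t q).
  rewrite -[X in _ --> X]subr0 -[X in _ - X](mul0r (a1 - xi * a0)).
  by apply: cvgB; apply: cvgM.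
have a00 : a0 < 0 by rewrite oppr_lt0 mulr_gt0// L0_gt0.
(* As [L 1 = xi * L 0] here, this is the sum in [L_variance_gt0], so the limit determinant does not
   vanish. *)
have v0 : 0 < L 2 t q - xi * L 1 t q.
  have := L_variance_gt0 q xi t0; rewrite s1; lra.
have det0 : a0 * (L 2 t q - xi * L 1 t q) != 0.
  by apply: mulf_neq0; [rewrite lt_eqF|rewrite gt_eqF].
have eqs : \forall y \near xi, det y != 0 /\
   (a y * (tf y - t) + b y * (qf y - q) = e y * (y - xi) /\
    c y * (tf y - t) + d y * (qf y - q) = L 0 t q * (y - xi)).
  near=> y; split.
    near: y; exact: (cvgr_neq0 _ cdet).
  have y0 : 0 < y by near: y; exact: near_pos.
  have [t'0 t'1 [s0' s1']] := tqP y0.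
  have ht : `|tf y - t| <= t / 2.
    by rewrite distrC; near: y; apply: (cvgr_dist_le _ _ tc); rewrite divr_gt0.
  have hq : `|qf y - q| <= 1.
    by rewrite distrC; near: y; apply: (cvgr_dist_le _ _ qc).
  have e0 := H0 _ _ ht hq; have e1 := H1 _ _ ht hq; have eE := HE (qf y * y).
  rewrite s1' s1 in e1; rewrite -s0' -s0 in eE.
  split.
    have : (L 0 (tf y) (qf y) - L 0 t q) = E (qf y * y) * ((qf y - q) * y + q * (y - xi)).
      by rewrite eE; congr (_ * _); ring.
    rewrite e0 /a /b /e; move: (A0 _ _) (B0 _ _) (E _) => ? ? ? h; clear - h; lra.
  have e2 : y * (L 0 (tf y) (qf y) - L 0 t q) = y * (A0 (tf y) (qf y) * (tf y - t) + B0 (tf y) (qf y) * (qf y - q)).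
    by rewrite e0.
  rewrite /c /d; move: e1 e2; move: (A0 _ _) (B0 _ _) (A1 _ _) (B1 _ _) => ? ? ? ? h1 h2.
  by clear - h1 h2; lra.
split.
  exists (fun y => (e y * d y - b y * L 0 t q) / det y).
    near=> y; have [dn [E1 E2]] : det y != 0 /\
     (a y * (tf y - t) + b y * (qf y - q) = e y * (y - xi) /\
      c y * (tf y - t) + d y * (qf y - q) = L 0 t q * (y - xi)) by near: y; exact: eqs.
    apply: (mulIf dn); rewrite mulrA divfK//.
    rewrite (_ : (y - xi) * (e y * d y - b y * L 0 t q) =
      d y * (e y * (y - xi)) - b y * (L 0 t q * (y - xi))); last by ring.
    by rewrite -E1 -E2 /det -/t; ring.
  have -> : tf' xi = (L 0 t q * q * (L 2 t q - xi * L 1 t q) - 0 * L 0 t q) /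
      (a0 * (L 2 t q - xi * L 1 t q)).
    by rewrite mul0r subr0 -mulf_div divff ?gt_eqF// mulr1 /a0 invrN mulrN [L 0 t q * q]mulrC.
  by apply: cvgM; [apply: cvgB; apply: cvgM => //; exact: cvg_cst|exact: cvgV].
exists (fun y => (a y * L 0 t q - c y * e y) / det y).
  near=> y; have [dn [E1 E2]] : det y != 0 /\
     (a y * (tf y - t) + b y * (qf y - q) = e y * (y - xi) /\
      c y * (tf y - t) + d y * (qf y - q) = L 0 t q * (y - xi)) by near: y; exact: eqs.
  apply: (mulIf dn); rewrite mulrA divfK//.
  rewrite (_ : (y - xi) * (a y * L 0 t q - c y * e y) = a y * (L 0 t q * (y - xi)) - c y * (e y * (y - xi))); last by ring.
  by rewrite -E1 -E2 /det -/q; ring.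
by apply: cvgM; [apply: cvgB; apply: cvgM => //; exact: cvg_cst|exact: cvgV].
Unshelve. all: by end_near. Qed.

Lemma L_curve_derivable b (c xi : R) : 0 < xi ->
  derivable (fun y => L b (tf y) (qf y + c)) xi 1.
Proof.
move=> xi0; have [t0 t1 _] := tqP xi0.
have [[D1 E1 c1] [D2 E2 c2]] := tf_qf_slope xi0.
have tc := tf_cvg xi0; have qc := qf_cvg xi0.
have qcc : qf y + c @[y --> xi] --> qf xi + c by apply: cvgD => //; exact: cvg_cst.
have [A [B [H cAB]]] := L_increment b (qf xi + c) t0.
have [cA cB] := cAB _ _ _ _ _ tc qcc.
pose D y := A (tf y) (qf y + c) * D1 y + B (tf y) (qf y + c) * D2 y.
have : has_slope (fun y => L b (tf y) (qf y + c)) xi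
    (- (ln 2 * L b (tf xi) (qf xi + c + 1)) * tf' xi + L b.+1 (tf xi) (qf xi + c) * qf' xi).
  exists D; last by apply: cvgD; apply: cvgM.
  near=> y.
  have e1 : tf y - tf xi = (y - xi) * D1 y by near: y.
  have e2 : qf y - qf xi = (y - xi) * D2 y by near: y.
  rewrite H.
  - rewrite (_ : qf y + c - (qf xi + c) = qf y - qf xi); last by ring.
    by rewrite e1 e2 /D; ring.
  - by rewrite distrC; near: y; apply: (cvgr_dist_le _ _ tc); rewrite divr_gt0.
  - by rewrite distrC; near: y; apply: (cvgr_dist_le _ _ qcc).
by move=> /has_slope_derive[].
Unshelve. all: by end_near. Qed.

Lemma tf_derivable xi : 0 < xi -> derivable tf xi 1 /\ derive1 tf xi = tf' xi.
Proof.
move=> /tf_qf_slope[/has_slope_derive h _]; split; first exact: ex_derive.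
by rewrite derive1E (derive_val (is_derive := h)).
Qed.

Lemma derive1_tf_near xi : 0 < xi -> {near xi, derive1 tf =1 tf'}.
Proof.
by move=> xi0; near=> y; apply: (tf_derivable _).2; near: y; exact: near_pos.
Unshelve. all: by end_near. Qed.

(** [tf'] is [qf * G]. Where q vanishes, the second derivative of t therefore requires only that [G]
    be differentiable, not the value of its derivative. *)
Let G xi := - (L 0 (tf xi) (qf xi) / (ln 2 * L 0 (tf xi) (qf xi + 1))).

Lemma G_derivable xi : 0 < xi -> derivable G xi 1.
Proof.
move=> xi0; apply: derivableN; apply: derivableM.
  have -> : (fun x => L 0 (tf x) (qf x)) = (fun x => L 0 (tf x) (qf x + 0)).
    by apply/funext => x; rewrite addr0.
  exact: L_curve_derivable.
apply: derivableV; last by apply: derivableM; [exact: derivable_cst|exact: L_curve_derivable].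
by rewrite mulf_neq0 ?gt_eqF ?ln2_gt0 ?L0_gt0 ?tf_gt0.
Qed.

Lemma tf'_is_derive xi : 0 < xi ->
  is_derive xi 1 (derive1 tf) (qf xi * 'D_1 G xi + G xi * qf' xi).
Proof.
move=> xi0; have [_ /has_slope_derive hq] := tf_qf_slope xi0.
have hG : is_derive xi 1 G ('D_1 G xi) by apply: DeriveDef => //; exact: G_derivable.
have tE : tf' = qf * G.
  by apply/funext => y; transitivity (qf y * G y) => //; rewrite /tf' /G mulrN mulrA.
have := is_deriveM hq hG; rewrite -tE => hM.
have Hn := derive1_tf_near xi0.
have Hn' : {near xi, tf' =1 derive1 tf} by apply: filterS Hn => y ->.
exact: (near_eq_is_derive Hn' hM).
Qed.

End ImplicitFunctions.

(** * Shape of the dimension spectrum *)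

Section Spectrum.
Variables (R : realType) (tf qf : R -> R).
Hypothesis tqP : forall xi : R, 0 < xi ->
  [/\ 0 < tf xi, tf xi <= 1 & solves xi (tf xi) (qf xi)].
Implicit Types (xi : R).

(** The Lebesgue mean of log d_1, by [integral_phi]. *)
Local Notation xi0 := (L 1 1 0 : R).

Lemma xi0_gt0 : 0 < xi0.
Proof.
apply: lt_le_trans (L1_ge_term 0 1 ltr01).
by rewrite mulr_gt0 ?wt_gt0// /lnS ln2_gt0.
Qed.

Lemma solves_xi0 : solves xi0 1 0.
Proof. by split; rewrite ?L0_1_0 ?mul0r ?expR0 ?mulr1. Qed.

Lemma tf_xi0 : tf xi0 = 1 /\ qf xi0 = 0.
Proof.
have [t0 _ s] := tqP xi0_gt0.
by have [-> ->] := solves_unique t0 ltr01 s solves_xi0.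
Qed.

(** As t(xi) <= 1, tangency at (1, 0) gives exp(q xi0) < [L 0 1 q] <= [L 0 t q] = exp(q xi) when q
    != 0; and q = 0 forces t = 1, hence xi = xi0. *)
Lemma qf_sgn xi : 0 < xi -> xi != xi0 -> 0 < qf xi * (xi - xi0).
Proof.
move=> h0 hxi; have [t0 t1 s] := tqP h0.
have [q0|q0] := eqVneq (qf xi) 0.
  have : L 0 (tf xi) 0 = 1 by have := proj1 s; rewrite q0 mul0r expR0.
  move: t1; rewrite le_eqVlt => /predU1P[t1|t1].
    by have := proj2 s; rewrite t1 q0 L0_1_0 mulr1 => /esym/eqP; rewrite (negPf hxi).
  by have := L0_lt 0 t0 t1; rewrite L0_1_0 => /[swap] ->; rewrite ltxx.
have h := solves_min (qf xi) ltr01 solves_xi0; have := lt_leif h.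
rewrite eq_sym q0 => h1.
have := lt_le_trans h1 (L0_le (qf xi) t0 t1); rewrite (proj1 s) ltr_expR => h2.
by rewrite mulrBr subr_gt0.
Qed.

Lemma qf_lt0 xi : 0 < xi < xi0 -> qf xi < 0.
Proof.
move=> /andP[h0 h1]; have := qf_sgn h0; rewrite lt_eqF// => /(_ isT).
by rewrite nmulr_lgt0// subr_lt0.
Qed.

Lemma qf_gt0 xi : xi0 < xi -> 0 < qf xi.
Proof.
move=> h1; have := qf_sgn (lt_trans xi0_gt0 h1); rewrite gt_eqF// => /(_ isT).
by rewrite pmulr_lgt0// subr_gt0.
Qed.

Let ratio xi := L 0 (tf xi) (qf xi) / (ln 2 * L 0 (tf xi) (qf xi + 1)).

Lemma ratio_gt0 xi : 0 < xi -> 0 < ratio xi.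
Proof. by move=> /tqP[t0 _ _]; rewrite divr_gt0 ?mulr_gt0 ?L0_gt0 ?ln2_gt0. Qed.

Lemma tf'E xi : tf' tf qf xi = - (qf xi * ratio xi).
Proof. by rewrite /tf' /ratio mulrA. Qed.

Lemma derive1_tf xi : 0 < xi -> derive1 tf xi = - (qf xi * ratio xi).
Proof. by move=> h; rewrite (tf_derivable tqP h).2 tf'E. Qed.

Lemma derive1_tf_gt0 xi : 0 < xi < xi0 -> 0 < derive1 tf xi.
Proof.
move=> /andP[h0 h1]; rewrite derive1_tf// oppr_gt0 nmulr_rlt0 ?ratio_gt0//.
by rewrite qf_lt0// h0.
Qed.

Lemma derive1_tf_xi0 : derive1 tf xi0 = 0.
Proof. by rewrite derive1_tf ?xi0_gt0// tf_xi0.2 mul0r oppr0. Qed.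

Lemma derive1_tf_lt0 xi : xi0 < xi -> derive1 tf xi < 0.
Proof.
move=> h; have h0 := lt_trans xi0_gt0 h.
by rewrite derive1_tf// oppr_lt0 mulr_gt0 ?ratio_gt0// qf_gt0.
Qed.

(** Since q(xi0) = 0, t'' is the negative factor [G] times q', and q' is the inverse of the variance
    of log d_1. *)
Lemma derive2_tf_xi0 : derivable (derive1 tf) xi0 1 /\ derive1 (derive1 tf) xi0 < 0.
Proof.
have D := tf'_is_derive tqP xi0_gt0; split; first exact: ex_derive.
have [t1 q0] := tf_xi0.
rewrite [X in X < 0]derive1E (derive_val (is_derive := D)) q0 mul0r add0r.
rewrite t1 /qf' t1 q0 add0r !mulr0 subr0 L0_1_0 mulr1.
have L10 : 0 < L 0 1 1 :> R by rewrite L0_gt0.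
have l2 := ln2_gt0 R.
have v : 0 < L 2 1 0 - xi0 * xi0 :> R.
  have := L_variance_gt0 0 xi0 (@ltr01 R); rewrite L0_1_0; lra.
rewrite mulNr oppr_lt0 mulr_gt0//; first by rewrite divr_gt0// mulr_gt0.
by rewrite invfM mulrA divff ?mul1r ?invr_gt0// oppr_eq0 gt_eqF// mulr_gt0.
Qed.

Lemma tf_lt (xi s q : R) : 0 < xi -> 0 < s -> L 0 s q < expR (q * xi) -> tf xi < s.
Proof. by move=> /tqP[t0 _ h] s0; exact: (solves_lt t0 s0 h). Qed.

(** As q tends to -oo only digit 1 survives: every other weight is at most 2^q times its value at q
    = 0. *)
Lemma L0_lt1 (e : R) : 0 < e -> exists2 q, q <= 0 & L 0 e q < 1 :> R.
Proof.
move=> e0; have l2 := ln2_gt0 R.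
have S0 := sumsL0 0 e0.
pose a := expR (- (e * ln 2)) : R.
have a1 : a < 1 by rewrite expR_lt1 oppr_lt0 mulr_gt0.
have L00 := L0_gt0 0 e0.
have r0 : 0 < (1 - a) / (2 * L 0 e 0) by rewrite divr_gt0 ?subr_gt0// mulr_gt0.
(* Chosen so that the digits above 1 contribute at most half of the gap 1 - a. *)
pose q := Num.min 0 (ln ((1 - a) / (2 * L 0 e 0)) / ln 2).
have q0 : q <= 0 by rewrite ge_min lexx.
have q1 : expR (q * ln 2) <= (1 - a) / (2 * L 0 e 0).
  rewrite -[leRHS]lnK ?posrE// ler_expR -ler_pdivlMr//.
  by rewrite /q ge_min lexx orbT.
exists q => //.
have s1 : sums (fun k => (if k is 0 then a else 0) + expR (q * ln 2) * wt e 0 k) (a + expR (q * ln 2) * L 0 e 0).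
  apply: sumsD; last exact: sumsZ.
  split; rewrite -(cvg_shiftS (series _)); rewrite (_ : (fun n => _) = fun=> a); first exact: cvg_cst.
  by apply/funext => n; rewrite /series /= big_mkord big_ord_recl/= big1 ?addr0.
apply: (@le_lt_trans _ _ (a + expR (q * ln 2) * L 0 e 0)); last first.
  have : expR (q * ln 2) * L 0 e 0 <= (1 - a) / 2.
    rewrite (_ : (1 - a) / 2 = (1 - a) / (2 * L 0 e 0) * L 0 e 0); last first.
      by field; rewrite gt_eqF.
    by rewrite ler_pM2r.
  lra.
apply: ler_sums (sumsL0 q e0) s1 => -[|k].
  rewrite /wt /lnS ln1 !mulr0 mul1r !sub0r -/a lerDl mulr_ge0 ?expR_ge0//.
rewrite add0r /wt -expRD ler_expR mul0r sub0r lerD2r ler_wnM2l//.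
by rewrite ler_ln ?posrE// ler_nat.
Qed.

Lemma tf_cvg0 : tf x @[x --> 0^'+] --> 0.
Proof.
apply/cvgrPdist_lt => e e0; have [q q0 hq] := L0_lt1 e0.
have h : expR (q * x) @[x --> (0:R)^'+] --> (1:R).
  have : expR (q * x) @[x --> (0:R)^'+] --> expR (q * 0).
    apply: continuous_cvg; first exact: continuous_expR.
    by apply: cvgMr; apply: cvg_at_right_filter; exact: cvg_id.
  by rewrite mulr0 expR0.
near=> x.
have x0 : 0 < x by near: x; exact: nbhs_right_gt.
have [t0 _ _] := tqP x0.
rewrite sub0r normrN gtr0_norm//; apply: (tf_lt x0 e0 (q := q)).
near: x; exact: (cvgr_gt _ h).
Unshelve. all: by end_near. Qed.

(** At q = 1 the line eventually wins: [L 0 e 1] < x < exp x. *)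
Lemma tf_cvgy : tf x @[x --> +oo] --> 0.
Proof.
apply/cvgrPdist_lt => e e0; near=> x.
have x0 : 0 < x by near: x; exact: nbhs_pinfty_gt.
have [t0 _ _] := tqP x0.
rewrite sub0r normrN gtr0_norm//; apply: (tf_lt x0 e0 (q := 1)).
rewrite mul1r; apply: lt_le_trans (expR_ge1Dx x).
have : L 0 e 1 < x by near: x; apply: nbhs_pinfty_gt; exact: num_real.
lra.
Unshelve. all: by end_near. Qed.

Lemma sum_inv_sqr_le2 n : \sum_(k < n) (k.+1%:R ^- 2) <= 2 :> R.
Proof.
case: n => [|n]; first by rewrite big_ord0.
apply: (@le_trans _ _ (2 - n.+1%:R^-1)); last by rewrite gerBl invr_ge0.
elim: n => [|n IH]; first by rewrite big_ord_recl big_ord0/= expr1n invr1; lra.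
rewrite big_ord_recr/=; apply: le_trans (lerD IH (lexx _)) _.
have n1 : 0 < n.+1%:R :> R by [].
have -> : n.+2%:R = n.+1%:R + 1 :> R by rewrite natr1.
move: (n.+1%:R : R) n1 => x x0.
have -> : 2 - x^-1 + (x + 1) ^- 2 = 2 - (x + 1)^-1 - (x * (x + 1) ^+ 2)^-1.
  by field; apply/andP; split; rewrite gt_eqF//; lra.
by rewrite gerBl invr_ge0 mulr_ge0 ?sqr_ge0 ?ltW.
Qed.

(** For q <= -2 the ratio of a weight to the first one is at most 1/(k+1)^2, and these sum to at
    most 2. *)
Lemma L0_le_first (t q : R) : 0 < t -> q <= -2 -> L 0 t q <= 2 * wt t q 0.
Proof.
move=> t0 q2.
have u0 k : 0 <= (k.+1%:R ^- 2 : R) by rewrite invr_ge0 exprn_ge0.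
have [s sle] := sums_bounded u0 sum_inv_sqr_le2.
rewrite mulrC; apply: (@le_trans _ _ (wt t q 0 * limn (series (fun k => k.+1%:R ^- 2 : R)))); last first.
  by rewrite ler_wpM2l// wt_ge0.
apply: ler_sums (sumsL0 q t0) (sumsZ _ s) => k.
rewrite -expR_lnS -expRM_natl -expRN /wt -expRD ler_expR /lnS ln1 mulr0 sub0r mul1r.
have := lnS_ge0 R k; rewrite /lnS.
have t2 : 0 <= t * ln 2 by rewrite mulr_ge0 ?ltW ?ln2_gt0.
have : 1 * (t * ln 2) <= k.+1%:R * (t * ln 2) by rewrite ler_wpM2r// ler1n.
move: (ln k.+1%:R) => l h l0; have : q * l <= -2 * l by rewrite ler_wpM2r.
lra.
Qed.

(** Here t' = -q times [ratio]. The term of digit 2 in [L 1 = x * L 0] <= x drives q to -oo; then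
    [ratio] is at least 1/2 by [L0_le_first], the first weight being independent of q. *)
Lemma derive1_tf_cvg0 : derive1 tf x @[x --> 0^'+] --> +oo.
Proof.
apply/cvgryPge => A.
have l2 := ln2_gt0 R; have l21 := ln2_le1 R.
(* N/2 >= A is the final bound, and N >= 3 ensures q + 1 <= -2. *)
pose N := 2 * `|A| + 3.
have NA : N / 2 >= A by have := ler_norm A; rewrite /N; lra.
have N3 : 3 <= N by rewrite lerDr mulr_ge0.
have d0 : 0 < ln 2 * expR (- (N + 2) * ln 2) by rewrite mulr_gt0 ?expR_gt0.
near=> x.
have x0 : 0 < x by near: x; exact: nbhs_right_gt.
have xx0 : x < xi0 by near: x; apply: nbhs_right_lt; exact: xi0_gt0.
have xd : x < ln 2 * expR (- (N + 2) * ln 2) by near: x; exact: nbhs_right_lt.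
have [t0 t1 [s0 s1]] := tqP x0.
have qneg : qf x < 0 by rewrite qf_lt0// x0.
have e1 : expR (qf x * x) <= 1 by rewrite expR_le1 nmulr_rle0 ?ltW.
have h := L1_ge_term (qf x) 1 t0; rewrite s1 s0 in h.
have h2 : ln 2 * wt (tf x) (qf x) 1 < ln 2 * expR (- (N + 2) * ln 2).
  apply: le_lt_trans xd; apply: le_trans h _.
  by rewrite -[leRHS]mulr1 ler_pM2l.
have qN : qf x < - N.
  move: h2; rewrite ltr_pM2l// ltr_expR /lnS => h2.
  have : tf x * ln 2 <= 1 * ln 2 by rewrite ler_pM2r.
  rewrite -(ltr_pM2r l2); lra.
rewrite derive1_tf// -mulNr /ratio.
have r : 2^-1 <= L 0 (tf x) (qf x) / (ln 2 * L 0 (tf x) (qf x + 1)).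
  rewrite ler_pdivlMr ?mulr_gt0 ?L0_gt0//.
  have q2 : qf x + 1 <= -2 by lra.
  have := L0_le_first t0 q2; have := L0_ge_term (qf x) 0 t0.
  rewrite {1 2}/wt /lnS ln1 !mulr0 => h3 h4.
  have : ln 2 * L 0 (tf x) (qf x + 1) <= L 0 (tf x) (qf x + 1).
    by rewrite -[leRHS]mul1r ler_pM2r// L0_gt0.
  lra.
apply: le_trans NA _; apply: ler_pM => //; lra.
Unshelve. all: by end_near. Qed.

(** Otherwise t' would be nonincreasing beyond xi0, hence bounded above by a negative constant, and
    t would leave (0, 1]. *)
Lemma derive2_tf_pos : exists xi1, xi0 < xi1 /\ derivable (derive1 tf) xi1 1 /\
  0 < derive1 (derive1 tf) xi1.
Proof.
apply: contrapT => H.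
have D xi : 0 < xi -> derivable (derive1 tf) xi 1.
  by move=> h; have Dx := tf'_is_derive tqP h; exact: ex_derive.
have le0 xi : xi0 < xi -> derive1 (derive1 tf) xi <= 0.
  move=> h; rewrite leNgt; apply/negP => h'; apply: H; exists xi; split=> //.
  by split=> //; apply: D; exact: lt_trans xi0_gt0 h.
have x0 := xi0_gt0.
have MV (f : R -> R) (a b : R) : 0 < a -> a < b -> (forall x, 0 < x -> derivable f x 1) ->
    exists2 c, a < c < b & f b - f a = derive1 f c * (b - a).
  move=> a0 ab Df.
  have [|x|c] := @MVT R f (derive1 f) a b ab _ _.
  - by move=> x; rewrite in_itv/= => /andP[ax _]; apply: DeriveDef; [apply: Df; exact: lt_trans ax|rewrite derive1E].
  - apply: derivable_within_continuous => y; rewrite in_itv/= => /andP[ay _].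
    by apply: Df; exact: lt_le_trans ay.
  - by rewrite in_itv/=; exists c.
pose a := xi0 + 1; have a0 : 0 < a by rewrite addr_gt0.
have xa : xi0 < a by rewrite ltrDl.
pose c := - derive1 tf a; have c0 : 0 < c by rewrite oppr_gt0 derive1_tf_lt0.
have gle x : a < x -> derive1 tf x <= - c.
  move=> ax; have [y /andP[ay _] e] := MV (derive1 tf) a x a0 ax D.
  rewrite /c opprK -subr_le0 e pmulr_lle0 ?subr_gt0//.
  by apply: le0; exact: lt_trans ay.
(* At slope at most -c, t loses at least 2 between a and b. *)
pose b := a + 2 / c.
have ab : a < b by rewrite ltrDl divr_gt0.
have [y /andP[ay _] e] := MV tf a b a0 ab (fun x h => (tf_derivable tqP h).1).
have [ta0 ta1 _] := tqP a0.
have [tb0 _ _] := tqP (lt_trans a0 ab).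
have : derive1 tf y * (b - a) <= - c * (b - a) by rewrite ler_pM2r ?subr_gt0// gle.
have -> : - c * (b - a) = - 2 by rewrite /b addrAC subrr add0r mulrC mulrN divfK// gt_eqF.
rewrite -e; lra.
Qed.

End Spectrum.

(** * Sums over words *)

Section Words.
Variable R : realType.

(** Induction on n, grouping the words by their first letter. Arbitrary duplicate-free lists serve
    both the finite subsets behind [esum] and the finite stages of a cover. *)
Lemma sum_words (a : R^nat) (A : R) n (F : seq (seq nat)) :
  (forall k, 0 <= a k) -> (forall K, \sum_(k < K) a k <= A) ->
  uniq F -> all (fun w => size w == n) F ->
  \sum_(w <- F) \prod_(k <- w) a k <= A ^+ n.
Proof.
move=> a0 aA; have A0 : 0 <= A by have := aA 0; rewrite big_ord0.
elim: n F => [|n IH] F uF sF.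
  case: F uF sF => [|w [|w' F]]; rewrite ?big_nil ?expr0//=.
    by rewrite andbT => _ /nilP->; rewrite big_seq1 big_nil.
  move=> /andP[/negP h _] /and3P[/nilP e1 /nilP e2 _]; case: h.
  by rewrite e1 e2 mem_head.
pose K := (\max_(w <- F) head 0 w).+1.
have hK w : w \in F -> (head 0 w < K)%N.
  by move=> wF; rewrite ltnS; exact: leq_bigmax_seq.
have cE w : w \in F -> w = head 0%N w :: behead w.
  by move=> /(allP sF); case: w.
have -> : \sum_(w <- F) \prod_(k <- w) a k =
    \sum_(i < K) \sum_(w <- F | head 0%N w == i) \prod_(k <- w) a k.
  rewrite (exchange_big_dep xpredT)//= big_seq [RHS]big_seq; apply: eq_bigr => w wF.
  by rewrite (big_pred1 (Ordinal (hK w wF))).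
apply: (@le_trans _ _ (\sum_(i < K) a i * A ^+ n)); last first.
  by rewrite -mulr_suml exprS ler_wpM2r// exprn_ge0.
apply: ler_sum => i _.
pose G := [seq behead w | w <- F & head 0%N w == i].
have -> : \sum_(w <- F | head 0%N w == i) \prod_(k <- w) a k =
    a i * \sum_(w <- G) \prod_(k <- w) a k.
  rewrite big_map big_filter mulr_sumr big_seq_cond [RHS]big_seq_cond.
  apply: eq_bigr => w /andP[wF /eqP wi].
  by rewrite {1}(cE w wF) big_cons wi.
rewrite ler_wpM2l//; apply: IH.
  rewrite map_inj_in_uniq ?filter_uniq// => w w'.
  rewrite !mem_filter => /andP[/eqP wi wF] /andP[/eqP w'i w'F] bb.
  by rewrite (cE w wF) (cE w' w'F) wi w'i bb.
apply/allP => w /mapP[w']; rewrite mem_filter => /andP[_ w'F] ->.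
by have := allP sF _ w'F; rewrite size_behead; case: w' {w'F} => //= _ s.
Qed.

Lemma esum_words_ge (a : R^nat) n K : (forall k, 0 <= a k) ->
  (((\sum_(k < K) a k) ^+ n)%:E <=
    \esum_(w in [set: {ffun 'I_n -> nat}]) (\prod_(i < n) a (w i))%:E)%E.
Proof.
move=> a0; pose J (f : {ffun 'I_n -> 'I_K}) : {ffun 'I_n -> nat} := [ffun i => val (f i)].
have Jinj : injective J.
  move=> f g /ffunP fg; apply/ffunP => i; apply: val_inj.
  by have := fg i; rewrite !ffunE.
pose F := [seq J f | f <- enum {ffun 'I_n -> 'I_K}].
apply: esum_ge; exists [set` F]; first by split=> //; exact: finite_seq.
rewrite -fsbig_seq; last by rewrite map_inj_uniq// enum_uniq.
rewrite big_map big_enum/= sumEFin lee_fin le_eqVlt; apply/orP; left; apply/eqP.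
under [RHS]eq_bigr => f _ do under eq_bigr => i _ do rewrite ffunE.
by rewrite -(bigA_distr_bigA (fun (_ : 'I_n) (j : 'I_K) => a j)) prodr_const card_ord.
Qed.

(** The upper bound is [sum_words]; the lower one uses the words over the first K letters, whose
    total is the n-th power of a partial sum. *)
Lemma esum_words (a : R^nat) s n : (forall k, 0 <= a k) -> sums a s ->
  (\esum_(w in [set: {ffun 'I_n -> nat}]) (\prod_(i < n) a (w i))%:E = (s ^+ n)%:E)%E.
Proof.
move=> a0 hs.
have up : (\esum_(w in [set: {ffun 'I_n -> nat}]) (\prod_(i < n) a (w i))%:E <= (s ^+ n)%:E)%E.
  apply: ge_ereal_sup => _ [X [Xf _] <-].
  rewrite fsbig_finite//= sumEFin lee_fin.
  have := finmap.fset_uniq (fset_set X); move: (finmap.enum_fset _) => F uF.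
  have -> : \sum_(w <- F) \prod_(i < n) a (w i) =
     \sum_(w <- [seq [seq (w : {ffun 'I_n -> nat}) i | i <- enum 'I_n] | w <- F]) \prod_(k <- w) a k.
    by rewrite big_map; apply: eq_bigr => w _; rewrite big_map big_enum.
  apply: sum_words => //.
  - by move=> K; exact: sums_partial.
  - rewrite map_inj_uniq// => f g /eq_in_map fg; apply/ffunP => i.
    by apply: fg; rewrite mem_enum.
  - by apply/allP => w /mapP[v _ ->]; rewrite size_map size_enum_ord.
apply/eqP; rewrite eq_le up/=.
have lo K := @esum_words_ge a n K a0.
move: up lo; case: (\esum_(_ in _) _)%E => [e| |] //.
  rewrite !lee_fin => _ lo.
  have c : (fun K => (\sum_(k < K) a k) ^+ n) @ \oo --> s ^+ n.
    have := sums_cvg hs => h.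
    have : (series a x) ^+ n @[x --> \oo] --> s ^+ n.
      have hc := @exprn_continuous R n s.
      exact: (@cvg_comp _ _ _ (series a) (fun x : R => x ^+ n) _ _ _ h hc).
    by apply: cvg_trans; apply: near_eq_cvg; apply: nearW => K; rewrite /series /= big_mkord.
  rewrite -(cvg_lim _ c)//; apply: limr_le; first exact: cvgP c.
  by apply: nearW => K; have := lo K; rewrite lee_fin.
by move=> _ /(_ 0%N); rewrite leeNy_eq.
Qed.

Lemma esum_words_lty (a : R^nat) : (forall k, 0 <= a k) ->
  (\esum_(w in [set: {ffun 'I_1 -> nat}]) (\prod_(i < 1) a (w i))%:E < +oo)%E ->
  exists s, sums a s.
Proof.
move=> a0; have lo K := @esum_words_ge a 1 K a0.
move: lo; case: (\esum_(_ in _) _)%E => [e| |] // lo _.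
  have [|s _] := @sums_bounded R a e a0; last by eexists; exact: s.
  by move=> K; have := lo K; rewrite lee_fin expr1.
by have := lo 0%N; rewrite leeNy_eq.
Qed.

End Words.

(** * Digits, cylinders and the pressure *)

Section Dynamics.
Variable R : realType.
Implicit Types (x y : R).

Lemma expR_half n : (2^-1) ^+ n = expR (- (n%:R * ln 2)) :> R.
Proof. by rewrite expRN expRM_natl lnK ?posrE// exprVn. Qed.

Lemma d1_eq x n : (2^-1) ^+ n.+1 < x <= (2^-1) ^+ n -> d1 x = n.+1.
Proof.
move=> /andP[lo hi]; have x0 : 0 < x by apply: lt_trans lo; rewrite exprn_gt0.
have l2 := ln2_gt0 R.
rewrite /d1 (@floor_def _ _ n%:Z)//.
rewrite -(lnK x0) !expR_half ltr_expR in lo; rewrite -(lnK x0) !expR_half ler_expR in hi.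
rewrite addrC -intS -!pmulrn -mulNr ler_pdivlMr// ltr_pdivrMr//; apply/andP; split.
  by rewrite lerNr.
by rewrite ltrNl.
Qed.

Lemma d1_bounds x : 0 < x <= 1 -> (2^-1) ^+ d1 x < x <= (2^-1) ^+ (d1 x).-1.
Proof.
move=> /andP[x0 x1]; have l2 := ln2_gt0 R.
have y0 : 0 <= - (ln x / ln 2).
  by rewrite oppr_ge0 pmulr_lle0 ?invr_gt0// ln_le0.
have f0 : 0 <= Num.floor (- (ln x / ln 2)) by rewrite floor_ge0.
have := floor_itv (- (ln x / ln 2)).
rewrite /d1/= -{1 2}(gez0_abs f0); move: (`|_|%N) => m.
rewrite addrC -intS -!pmulrn.
have lE : ln x = - (- (ln x / ln 2)) * ln 2 by rewrite opprK divfK ?gt_eqF.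
move: (- (ln x / ln 2)) lE => z lE /andP[h1 h2].
have -> : x = expR (- z * ln 2) by rewrite -lE lnK.
by rewrite !expR_half ltr_expR ler_expR -!mulNr ltr_pM2r// ler_pM2r// ltrN2 lerN2 h2.
Qed.

Lemma Tmap_bounds x : 0 < x <= 1 -> 0 < Tmap x <= 1.
Proof.
move=> /d1_bounds; rewrite /Tmap /d1 succnK; move: (`|_|%N) => m /andP[h1 h2].
have p : 0 < 2 ^+ m.+1 :> R by rewrite exprn_gt0.
rewrite subr_gt0 lerBlDr; apply/andP; split.
  by move: h1; rewrite -(ltr_pM2l p) exprVn divff// gt_eqF.
have e : 2 ^+ m.+1 * (2^-1) ^+ m = 2 :> R.
  by rewrite exprS exprVn -mulrA divff ?mulr1// gt_eqF// exprn_gt0.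
by have h := h2; rewrite -(ler_pM2l p) e in h; lra.
Qed.

Lemma iter_Tmap_bounds n x : 0 < x <= 1 -> 0 < iter n (@Tmap R) x <= 1.
Proof. by move=> hx; elim: n => //= n; exact: Tmap_bounds. Qed.

Lemma Tmap_decomp x : x = (2^-1) ^+ d1 x * (1 + Tmap x).
Proof. by rewrite /Tmap addrC subrK exprVn mulKf// gt_eqF// exprn_gt0. Qed.

Definition branch n (y : R) : R := (2^-1) ^+ n * (1 + y).

Lemma branchP n (y : R) : (0 < n)%N -> 0 < y <= 1 ->
  [/\ 0 < branch n y <= 1, d1 (branch n y) = n & Tmap (branch n y) = y].
Proof.
case: n => // n _ /andP[y0 y1].
have p : 0 < (2^-1) ^+ n.+1 :> R by rewrite exprn_gt0.
have D : d1 (branch n.+1 y) = n.+1.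
  apply: d1_eq; rewrite /branch -[ltLHS]mulr1 ltr_pM2l// ltrDl y0/=.
  by rewrite exprS [2^-1 * _]mulrC -mulrA -[leRHS]mulr1 ler_pM2l ?exprn_gt0//; lra.
split=> //.
  apply/andP; split; first by rewrite mulr_gt0// addr_gt0.
  have : (2^-1) ^+ n <= 1 :> R by rewrite exprn_ile1//; lra.
  have : 0 <= (2^-1) ^+ n :> R by rewrite exprn_ge0.
  rewrite /branch exprS; nra.
by rewrite /Tmap D /branch exprVn mulVKf ?gt_eqF ?exprn_gt0// addrC addKr.
Qed.

(** Inverse branches applied to the endpoint 1; this point witnesses that cylinders are nonempty. *)
Definition point (s : seq nat) : R := foldr branch 1 s.

Lemma pointP (s : seq nat) : all (ltn 0) s -> 0 < point s <= 1 /\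
  forall i, (i < size s)%N -> d1 (iter i (@Tmap R) (point s)) = nth 0%N s i.
Proof.
elim: s => [_|k s IH /= /andP[k0 /IH[ps dS]]]; first by rewrite /= ltr01 lexx.
have [b1 b2 b3] := branchP k0 ps; split=> // -[_|i si] //.
by rewrite iterSr b3; exact: dS.
Qed.

Lemma expR_birkhoff_cylinder n (t q : R) (w : {ffun 'I_n -> nat}) x :
  cylinder [ffun i => (w i).+1] x ->
  expR (birkhoff (fun y => - t * ln `|Tder y| + q * phi y) n x) = \prod_(i < n) wt t q (w i).
Proof.
move=> [_ H]; rewrite /birkhoff expR_sum; apply: eq_bigr => i _.
have := H i; rewrite ffunE => dE.
have l : ln (2 ^+ (w i).+1) = (w i).+1%:R * ln 2 :> R by rewrite lnXn// mulr_natl.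
rewrite /Tder /phi dE ger0_norm ?exprn_ge0// l /wt /lnS.
by congr expR; ring.
Qed.

(** The Birkhoff sum is constant on a cylinder, so the supremum is that constant; nonemptiness of
    the cylinder excludes -oo. *)
Lemma ZnE n (t q : R) :
  (Zn n t q = \esum_(w in [set: {ffun 'I_n -> nat}]) (\prod_(i < n) wt t q (w i))%:E)%E.
Proof.
rewrite /Zn (@reindex_esum _ _ _ [set: {ffun 'I_n -> nat}] _
  (fun w : {ffun 'I_n -> nat} => [ffun i => (w i).+1])); last first.
  split.
  - by move=> w _ i; rewrite ffunE.
  - move=> v w _ _ /ffunP vw; apply/ffunP => i.
    by have := vw i; rewrite !ffunE => -[].
  - move=> w w0; exists [ffun i => (w i).-1] => //.
    by apply/ffunP => i; rewrite !ffunE prednK.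
apply: eq_esum => w _.
set v : {ffun 'I_n -> nat} := [ffun i => (w i).+1].
have [y yc] : cylinder (R := R) v !=set0.
  have [|b1 b2] := @pointP [seq v i | i <- enum 'I_n].
    by rewrite all_map; apply/allP => i _ /=; rewrite /v ffunE.
  exists (point [seq v i | i <- enum 'I_n]); split=> // i.
  rewrite b2; last by rewrite size_map size_enum_ord.
  by rewrite (nth_map i 0%N) ?size_enum_ord// nth_ord_enum.
have -> : [set (birkhoff (fun y => - t * ln `|Tder y| + q * phi y) n x)%:E | x in cylinder v]
    = [set (ln (\prod_(i < n) wt t q (w i)))%:E].
  apply/seteqP; split=> [_ [x xc <-]|_ ->].
    by rewrite /= -(expR_birkhoff_cylinder _ _ xc) expRK.
  by exists y => //; rewrite -(expR_birkhoff_cylinder _ _ yc) expRK.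
rewrite ereal_sup1/= lnK// posrE prodr_gt0// => i _; exact: wt_gt0.
Qed.

Lemma pdom_sums (t q : R) : pdom t q -> exists s, sums (wt t q) s.
Proof.
by move=> /(_ 1%N isT); rewrite ZnE; apply: esum_words_lty => k; exact: wt_ge0.
Qed.

Lemma sums_Zn (t q s : R) n : sums (wt t q) s -> Zn n t q = (s ^+ n)%:E.
Proof. by move=> h; rewrite ZnE; apply: esum_words => // k; exact: wt_ge0. Qed.

Lemma sums_pdom (t q s : R) : sums (wt t q) s -> pdom t q.
Proof. by move=> h n _; rewrite (sums_Zn _ h) ltry. Qed.

Lemma sums_pseq (t q s : R) : sums (wt t q) s -> pseq t q @ \oo --> ln s.
Proof.
move=> h; have s0 : 0 < s by apply: (sums_gt0 (n := 0) _ _ h) => *; rewrite ?wt_ge0 ?wt_gt0.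
apply: cvg_near_cst; near=> n; rewrite /pseq (sums_Zn _ h)/= lnXn//.
rewrite -[ln s *+ n]mulr_natl mulKf// pnatr_eq0 -lt0n; near: n; exact: nbhs_infty_gt.
Unshelve. all: by end_near. Qed.

Lemma sums_P (t q s : R) : sums (wt t q) s -> P t q = ln s.
Proof. by move=> /sums_pseq h; apply/cvg_lim. Qed.

Lemma sums_limn_powR (t q s : R) : sums (wt t q) s ->
  limn (fun N : nat => \sum_(1 <= k < N) (2 `^ (- (k%:R * t)) * k%:R `^ q)) = s.
Proof.
move=> [h]; apply/cvg_lim => //; rewrite -cvg_shiftS/=.
apply: cvg_trans h; apply: near_eq_cvg; apply: nearW => N.
rewrite /series /= big_add1/=; apply: eq_bigr => k _.
by rewrite /wt powR2E /powR pnatr_eq0/= -expRD /lnS; congr expR; ring.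
Qed.

Lemma P_L0 (t q : R) : 0 < t -> P t q = ln (L 0 t q).
Proof. by move=> t0; apply: sums_P; exact: sumsL0. Qed.

Lemma pdom_pos (t q : R) : 0 < t -> pdom t q.
Proof. by move=> t0; apply: sums_pdom (sumsL0 q t0). Qed.

(** If q >= 0 the terms do not tend to 0; if q < 0 the first term is at least 1, so the sum exceeds
    1 and P > 0 > q xi. *)
Lemma pdom_nonpos (t q xi : R) : 0 < xi -> t <= 0 -> pdom t q -> P t q <> q * xi.
Proof.
move=> xi0 t0 /pdom_sums[s h] PE.
have l2 := ln2_gt0 R.
have [q0|q0] := leP 0 q.
  have [h'] := h; have /cvg_series_cvg_0 : cvgn (series (wt t q)) by exact: cvgP h'.
  move=> /(cvgr_lt _); move=> /(_ 1 ltr01) [N _] /(_ N (leqnn N)).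
  apply/negP; rewrite -leNgt -expR0 ler_expR subr_ge0.
  apply: (@le_trans _ _ 0); last by rewrite mulr_ge0 ?lnS_ge0.
  by rewrite pmulr_rle0// pmulr_lle0.
have s1 : 1 < s.
  have := sums_partial 2 (fun k => wt_ge0 t q k) h.
  rewrite !big_ord_recr big_ord0/= add0r; apply: lt_le_trans.
  have := wt_gt0 t q 1; have : 1 <= wt t q 0; last by lra.
  rewrite -expR0 ler_expR /lnS ln1 mulr0 sub0r mul1r oppr_ge0.
  by rewrite pmulr_lle0.
have : 0 < q * xi by rewrite -PE (sums_P h) ln_gt0.
by rewrite pmulr_lgt0// ltNge ltW.
Qed.



End Dynamics.

(** * Upper bound for the dimension *)

Section UpperBound.
Variable R : realType.

Lemma diam_ub (U : set R) (d : R) : 0 <= d -> diam_le U d -> diam U <= d.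
Proof.
move=> d0 Ud; rewrite /diam.
have [->|/set0P S0] := eqVneq [set r : R | exists x y, U x /\ U y /\ r = `|x - y|] set0.
  by rewrite sup0.
by apply: ge_sup => // _ [x [y [Ux [Uy ->]]]]; exact: Ud.
Qed.

(** Boundedness matters because [sup] takes the value 0 on sets without a supremum. *)
Lemma le_diam (U : set R) (d x y : R) : diam_le U d -> U x -> U y -> `|x - y| <= diam U.
Proof.
move=> Ud Ux Uy; apply: sup_upper_bound; last by exists x, y.
split; first by exists `|x - y|, x, y.
by exists d => _ [u [v [Uu [Uv ->]]]]; exact: Ud.
Qed.

Lemma diam_ge0 (U : set R) : 0 <= diam U.
Proof.
rewrite /diam; have [hs|/sup_out->//] := pselect (has_sup [set r : R | exists x y, U x /\ U y /\ r = `|x - y|]).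
have [[r Sr] _] := hs; apply: le_trans (sup_upper_bound hs Sr).
by case: Sr => [x [y [_ [_ ->]]]].
Qed.

Lemma diam_set0 : diam (@set0 R) = 0.
Proof.
rewrite /diam (_ : [set r | _] = set0) ?sup0//.
by apply/seteqP; split => // r [x [y []]].
Qed.

Definition cyl (v : seq nat) : set R := [set x | 0 < x <= 1 /\
  forall i, (i < size v)%N -> d1 (iter i (@Tmap R) x) = (nth 0%N v i).+1].

Lemma cyl_diam (v : seq nat) : diam_le (cyl v) ((2^-1) ^+ (\sum_(k <- v) k.+1)).
Proof.
elim: v => [|k v IH] x y [xb xd] [yb yd].
  rewrite big_nil expr0 ler_norml; move: xb yb => /andP[? ?] /andP[? ?].
  by apply/andP; split; lra.
have xk : d1 x = k.+1 by exact: (xd 0%N).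
have yk : d1 y = k.+1 by exact: (yd 0%N).
rewrite (Tmap_decomp x) (Tmap_decomp y) xk yk big_cons exprD -mulrBr normrM.
rewrite ger0_norm ?exprn_ge0// ler_wpM2l ?exprn_ge0//.
rewrite (_ : _ - _ = Tmap x - Tmap y); last by ring.
by apply: IH; (split; first exact: Tmap_bounds) => i iv;
  rewrite -iterSr; [apply: (xd i.+1)|apply: (yd i.+1)].
Qed.

(** Grouped by length, the sum is dominated by the tail of a geometric series. *)
Lemma sum_words_sizes (a : R^nat) (A : R) n0 (F : seq (seq nat)) :
  (forall k, 0 <= a k) -> (forall K, \sum_(k < K) a k <= A) -> A < 1 -> uniq F ->
  \sum_(w <- F | (n0 <= size w)%N) \prod_(k <- w) a k <= A ^+ n0 / (1 - A).
Proof.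
move=> a0 aA A1 uF; have A0 : 0 <= A by have := aA 0; rewrite big_ord0.
pose K := (\max_(w <- F) size w).+1.
have hK w : w \in F -> (size w - n0 < K)%N.
  move=> wF; rewrite ltnS; apply: leq_trans (leq_subr _ _) _.
  exact: leq_bigmax_seq.
have -> : \sum_(w <- F | (n0 <= size w)%N) \prod_(k <- w) a k =
    \sum_(i < K) \sum_(w <- F | size w == (n0 + i)%N) \prod_(k <- w) a k.
  rewrite (exchange_big_dep (fun w => n0 <= size w)%N)//=; last first.
    by move=> i w _ /eqP->; rewrite leq_addr.
  rewrite big_seq_cond [RHS]big_seq_cond; apply: eq_bigr => w /andP[wF nw].
  rewrite (big_pred1 (Ordinal (hK w wF)))//= => i.
  apply/eqP/eqP => [h|->/=]; last by rewrite subnKC.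
  by apply: val_inj; rewrite /= h addKn.
apply: (@le_trans _ _ (\sum_(i < K) A ^+ n0 * A ^+ i)); last first.
  rewrite -mulr_sumr ler_wpM2l ?exprn_ge0// -[leRHS]mul1r ler_pdivlMr ?subr_gt0//.
  have := subrX1 A K; have : 0 <= A ^+ K by rewrite exprn_ge0.
  by move: (\sum_(i < K) _) => S; nra.
apply: ler_sum => i _; rewrite -exprD -big_filter; apply: sum_words => //.
  exact: filter_uniq.
by apply/allP => w; rewrite mem_filter => /andP[].
Qed.

(** Covers are indexed by [nat], so words enter through their codes; an index that codes no word
    contributes 0. *)
Lemma big_pickle_inv (T : countType) (h : T -> R) N :
  \sum_(i < N) (if @pickle_inv T i is Some v then h v else 0) =
  \sum_(v <- pmap (@pickle_inv T) (iota 0 N)) h v.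
Proof.
rewrite -(big_mkord xpredT (fun i => if @pickle_inv T i is Some v then h v else 0)).
rewrite /index_iota subn0; elim: (iota 0 N) => [|i s IH]; first by rewrite !big_nil.
by rewrite big_cons IH /=; case: (@pickle_inv T i) => [v|]; rewrite ?big_cons ?add0r.
Qed.

(* The cylinders of all orders [n >= n0] on which the Birkhoff average is close
   to [xi] form a single cover; the weight [expR (- q * xi) * wt s q], slightly
   inflated, has total mass [A < 1], so that the cover has size O(A ^+ n0). *)
Lemma hausdorff_null_Ephi (s q xi : R) : 0 < s -> L 0 s q < expR (q * xi) ->
  hausdorff_null s (Ephi xi).
Proof.
move=> s0 hL eps eps0.
have L0 := L0_gt0 q s0; have l2 := ln2_gt0 R.
have h1 : ln (L 0 s q) < q * xi by rewrite -ltr_expR lnK.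
(* Deviations of size d cost at most half of the gap q xi - ln L, so [A] stays below 1; the added 1
   covers q = 0. *)
pose d := (q * xi - ln (L 0 s q)) / (2 * (`|q| + 1)).
have q1 : 0 < `|q| + 1 by rewrite ltr_wpDl.
have d0 : 0 < d by rewrite divr_gt0 ?subr_gt0// mulr_gt0.
pose c := expR (- (q * xi) + `|q| * d).
pose A := c * L 0 s q.
have A0 : 0 < A by rewrite mulr_gt0// expR_gt0.
have A1 : A < 1.
  rewrite /A -[X in _ * X](lnK L0) -expRD expR_lt1.
  have : `|q| * d <= (q * xi - ln (L 0 s q)) / 2.
    rewrite /d mulrCA ler_pM2l ?subr_gt0// invfM mulrCA -[leRHS]mulr1 ler_pM2l//.
    by rewrite ler_pdivrMr// mul1r lerDl.
  lra.
pose a k := c * wt s q k.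
have a0 k : 0 <= a k by rewrite mulr_ge0 ?expR_ge0 ?wt_ge0.
have aA K : \sum_(k < K) a k <= A.
  by rewrite -mulr_sumr ler_wpM2l ?expR_ge0//; apply: sums_partial (sumsL0 q s0) => k; exact: wt_ge0.
have [n0 [n01 n0A n0e]] : exists n0, [/\ (0 < n0)%N, A ^+ n0 / (1 - A) <= eps & (2^-1) ^+ n0 <= eps].
  have cA : A ^+ n / (1 - A) @[n --> \oo] --> 0.
    rewrite -[X in _ --> X](mul0r (1 - A)^-1); apply: cvgMl.
    by apply: cvg_expr; rewrite gtr0_norm.
  have c2 : (2^-1 : R) ^+ n @[n --> \oo] --> 0.
    by apply: cvg_expr; rewrite gtr0_norm//; lra.
  have : \forall n \near \oo, [/\ (0 < n)%N, A ^+ n / (1 - A) <= eps & (2^-1) ^+ n <= eps].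
    near=> n; split; first by near: n; exact: nbhs_infty_gt.
      near: n; exact: (cvgr_le _ cA).
    near: n; exact: (cvgr_le _ c2).
  by move=> /filter_ex.
pose good (v : seq nat) := (n0 <= size v)%N &&
  (`|\sum_(k <- v) lnS R k - (size v)%:R * xi| <= (size v)%:R * d).
pose U i : set R := if @pickle_inv (seq nat) i is Some v then
  if good v then cyl v else set0 else set0.
exists U; split; [|split].
- move=> x [xb xphi].
  have [n [nn0 hn]] : exists n, (n0 <= n)%N /\ `|xi - n%:R^-1 * birkhoff (@phi R) n x| <= d.
    have : \forall n \near \oo, (n0 <= n)%N /\ `|xi - n%:R^-1 * birkhoff (@phi R) n x| <= d.
      near=> n; split; first by near: n; exact: nbhs_infty_ge.
      near: n; exact: (cvgr_dist_le _ _ xphi).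
    by move=> /filter_ex.
  pose v := mkseq (fun i => (d1 (iter i (@Tmap R) x)).-1) n.
  have np : 0 < n%:R :> R by rewrite ltr0n (leq_trans n01).
  exists (pickle v) => //; rewrite /U pickleK_inv ifT.
    split=> // i; rewrite size_mkseq => iv; rewrite nth_mkseq//.
  rewrite /good size_mkseq nn0/= big_map.
  have -> : \sum_(j <- iota 0 n) lnS R (d1 (iter j (@Tmap R) x)).-1 = birkhoff (@phi R) n x.
    rewrite /birkhoff -(big_mkord xpredT (fun j => phi (iter j (@Tmap R) x))).
    by rewrite /index_iota subn0; apply: eq_bigr.
  have -> : birkhoff (@phi R) n x - n%:R * xi = - (n%:R * (xi - n%:R^-1 * birkhoff (@phi R) n x)).
    by rewrite mulrBr mulVKf ?gt_eqF// opprB.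
  by rewrite normrN normrM gtr0_norm// ler_pM2l.
- move=> i x y; rewrite /U; case: pickle_inv => [v|//]; case: ifP => [/andP[nv _] xv yv|//].
  apply: le_trans n0e; apply: le_trans (cyl_diam xv yv) _.
  apply: ler_wiXn2l; rewrite ?invr_ge0//; first by lra.
  apply: leq_trans nv _; elim: v {xv yv} => // k v IH.
  by rewrite big_cons /= (leq_add (ltn0Sn k) IH).
- move=> N; apply: le_trans n0A.
  apply: le_trans (sum_words_sizes n0 a0 aA A1 (pmap_uniq (@pickle_invK _) (iota_uniq 0 N))).
  pose h (v : seq nat) := if (n0 <= size v)%N then \prod_(k <- v) a k else 0.
  have -> : \sum_(w <- pmap pickle_inv (iota 0 N) | (n0 <= size w)%N) \prod_(k <- w) a k =
      \sum_(i < N) (if pickle_inv i is Some v then h v else 0).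
    by rewrite big_mkcond (big_pickle_inv h).
  apply: ler_sum => i _; rewrite /h.
  rewrite /U; case: (pickle_inv i) => [v|]; last by rewrite diam_set0 powR0 ?gt_eqF.
  case: ifP => [/andP[nv gv]|_]; last first.
    by rewrite diam_set0 powR0 ?gt_eqF//; case: ifP => // _; rewrite prodr_ge0.
  rewrite nv; set m := (\sum_(k <- v) k.+1)%N.
  have dm : diam (cyl v) <= expR (- (m%:R * ln 2)).
    by rewrite -expR_half; apply: diam_ub; [rewrite exprn_ge0|exact: cyl_diam].
  apply: (@le_trans _ _ (expR (- (m%:R * ln 2)) `^ s)).
    by apply: ge0_ler_powR; rewrite ?nnegrE ?expR_ge0 ?diam_ge0 ?(ltW s0).
  rewrite -expRM.
  have -> : \prod_(k <- v) a k =
      expR (\sum_(k <- v) (- (q * xi) + `|q| * d + (q * lnS R k - k.+1%:R * (s * ln 2)))).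
    by rewrite expR_sum; apply: eq_bigr => k _; rewrite expRD.
  rewrite ler_expR big_split/= sumrB -mulr_sumr -mulr_suml -natr_sum -/m.
  rewrite big_const_seq count_predT iter_addr_0 -[X in _ <= X + _]mulr_natl.
  have : q * (\sum_(k <- v) lnS R k - (size v)%:R * xi) >= - (`|q| * ((size v)%:R * d)).
    rewrite lerNl; apply: le_trans (ler_norm _) _; rewrite normrN normrM.
    by rewrite ler_wpM2l.
  move: (\sum_(k <- v) lnS R k) => S hh; lra.
Unshelve. all: by end_near. Qed.

End UpperBound.

(** * Binary digits *)

Section Bits.
Variable R : realType.
Implicit Types (x y : R) (m n : nat) (b : seq bool).

(** The doubling map with 1/2 sent to 1: dyadic cells are open on the left, like the cylinders of T,
    and expansions have infinitely many ones. *)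
Definition dbl x : R := 2 * x - (2^-1 < x)%R%:R.

Lemma dbl_bounds x : 0 < x <= 1 -> 0 < dbl x <= 1.
Proof.
rewrite /dbl => /andP[x0 x1].
by case: (ltP 2^-1 x) => h; rewrite /= ?subr0; apply/andP; split; lra.
Qed.

Fixpoint bits m x : seq bool := if m is n.+1 then (2^-1 < x) :: bits n (dbl x) else [::].

Lemma size_bits m x : size (bits m x) = m.
Proof. by elim: m x => //= m IH x; rewrite IH. Qed.

Fixpoint bval b : nat := if b is c :: b' then (c * 2 ^ size b' + bval b')%N else 0%N.

Lemma bval_lt b : (bval b < 2 ^ size b)%N.
Proof.
elim: b => //= c b IH; rewrite expnS mul2n -addnn.
by case: c; rewrite ?mul1n ?mul0n ?add0n ?ltn_add2l// (leq_trans IH)// leq_addr.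
Qed.

Lemma bval_inj b b' : size b = size b' -> bval b = bval b' -> b = b'.
Proof.
elim: b b' => [|c b IH] [|c' b'] //= [sb] e.
have := bval_lt b; have := bval_lt b'; rewrite sb in e * => h1 h2.
case: c c' e => -[]; rewrite ?mul1n ?mul0n ?add0n.
- by move=> /eqP; rewrite eqn_add2l => /eqP /(IH _ sb)->.
- by move=> e; move: h1; rewrite -e ltnNge leq_addr.
- by move=> e; move: h2; rewrite e ltnNge leq_addr.
- by move=> /(IH _ sb)->.
Qed.

Lemma bval_rcons b c : bval (rcons b c) = (2 * bval b + c)%N.
Proof.
elim: b => [|d b IH] /=; first by rewrite muln1 muln0 addn0.
by rewrite IH size_rcons expnS; rewrite mulnDr mulnCA addnA.
Qed.

Lemma bits_decomp m x : 2 ^+ m * x = (bval (bits m x))%:R + iter m dbl x.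
Proof.
elim: m x => [|m IH] x; first by rewrite expr0 mul1r add0r.
rewrite /= size_bits natrD natrM natrX -addrA -iterS iterSr -IH exprS.
by rewrite /dbl; ring.
Qed.

Lemma iter_dbl_bounds m x : 0 < x <= 1 -> 0 < iter m dbl x <= 1.
Proof. by move=> hx; elim: m => //= m; exact: dbl_bounds. Qed.

Lemma bits_unique m x b : 0 < x <= 1 -> size b = m ->
  (bval b)%:R < 2 ^+ m * x <= (bval b).+1%:R -> bits m x = b.
Proof.
move=> hx sb; rewrite bits_decomp.
have /andP[y0 y1] := iter_dbl_bounds m hx; move=> /andP[h1 h2].
apply: bval_inj; first by rewrite size_bits.
have g1 : (bval (bits m x) < (bval b).+1)%N.
  by rewrite -(ltr_nat R); apply: lt_le_trans h2; rewrite ltrDl.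
have g2 : (bval b < (bval (bits m x)).+1)%N.
  by rewrite -(ltr_nat R); apply: lt_le_trans h1 _; rewrite -natr1 lerD2l.
by apply/eqP; rewrite eqn_leq -ltnS g1 -ltnS.
Qed.

(** Beside the leftmost cell met by [S], only its right neighbour can be met. Each listed cell
    contains a point of [S], since mass bounds are available only along such points. *)
Lemma small_set_two_cells (S : set R) m : S `<=` [set x | 0 < x <= 1] ->
  diam_le S ((2^-1) ^+ m) -> exists cs : seq (seq bool),
  [/\ (size cs <= 2)%N, (forall c, c \in cs -> exists2 x, S x & c = bits m x) &
      (forall x, S x -> bits m x \in cs)].
Proof.
move=> S01 Sd; have [->|/set0P[z Sz]] := eqVneq S set0; first by exists [::].
have ex : exists n, `[< exists2 x, S x & bval (bits m x) = n >].
  by exists (bval (bits m z)); apply/asboolP; exists z.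
case: (ex_minnP ex) => n /asboolP[x0 Sx0 x0n] nmin.
have near x : S x -> bval (bits m x) = n \/ bval (bits m x) = n.+1.
  move=> Sx; have nx : (n <= bval (bits m x))%N by apply: nmin; apply/asboolP; exists x.
  have : (bval (bits m x) < n.+2)%N.
    rewrite -(ltr_nat R).
    have p : 0 < 2 ^+ m :> R by rewrite exprn_gt0.
    have h1 := bits_decomp m x; have h2 := bits_decomp m x0; rewrite x0n in h2.
    have /andP[a0 a1] := iter_dbl_bounds m (S01 _ Sx).
    have /andP[b0 b1] := iter_dbl_bounds m (S01 _ Sx0).
    have : 2 ^+ m * (x - x0) <= 1.
      have e : 2 ^+ m * (2^-1) ^+ m = 1 :> R by rewrite exprVn divff// gt_eqF.
      apply: (@le_trans _ _ (2 ^+ m * (2^-1) ^+ m)); last by rewrite e.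
      by rewrite ler_pM2l//; apply: le_trans (ler_norm _) _; exact: Sd.
    have n2 : n.+2%:R = n%:R + 1 + 1 :> R by rewrite !natr1.
    by rewrite mulrBr h1 h2 n2; lra.
  rewrite ltnS leq_eqVlt => /orP[/eqP->|]; first by right.
  by rewrite ltnS => xn; left; apply/eqP; rewrite eqn_leq xn.
have sz x y : S x -> S y -> bval (bits m x) = bval (bits m y) -> bits m x = bits m y.
  by move=> _ _; apply: bval_inj; rewrite !size_bits.
have [[x1 Sx1 x1n]|no] := pselect (exists2 x, S x & bval (bits m x) = n.+1).
  exists [:: bits m x0; bits m x1]; split=> // [c|x Sx].
    by rewrite !inE => /orP[]/eqP->; [exists x0|exists x1].
  rewrite !inE; have [xn|xn] := near x Sx.
    by rewrite (sz x x0) ?eqxx// xn x0n.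
  by rewrite (sz x x1) ?eqxx ?orbT// xn x1n.
exists [:: bits m x0]; split=> // [c|x Sx].
  by rewrite inE => /eqP->; exists x0.
rewrite inE; have [xn|xn] := near x Sx; last by case: no; exists x.
by rewrite (sz x x0) ?eqxx// xn x0n.
Qed.

(** The point is the supremum of the left endpoints; infinitely many ones make it exceed each of
    them strictly, as left-open cells require. *)
Lemma point_of_path (beta : nat -> bool) :
  (forall m, exists2 k, (m <= k)%N & beta k) ->
  exists2 x, 0 < x <= 1 & forall m, bits m x = mkseq beta m.
Proof.
move=> inf.
pose v m := bval (mkseq beta m).
have vS m : v m.+1 = (2 * v m + beta m)%N by rewrite /v mkseqS bval_rcons.
pose l m : R := (v m)%:R / 2 ^+ m.
have p m : 0 < 2 ^+ m :> R by rewrite exprn_gt0.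
have lS m : l m.+1 = l m + (beta m)%:R / 2 ^+ m.+1.
  rewrite /l vS natrD natrM exprS; field; rewrite gt_eqF//.
have lmono m k : l m <= l (m + k)%N.
  elim: k => [|k IH]; first by rewrite addn0.
  by rewrite addnS lS; apply: le_trans IH _; rewrite lerDl divr_ge0 ?exprn_ge0.
have umono m k : l (m + k)%N + (2 ^+ (m + k))^-1 <= l m + (2 ^+ m)^-1.
  elim: k => [|k IH]; first by rewrite addn0.
  apply: le_trans IH; rewrite addnS lS -addrA lerD2l.
  have -> : (2 ^+ (m + k))^-1 = 2 / 2 ^+ (m + k).+1 :> R.
    by rewrite exprS; field; rewrite gt_eqF.
  by rewrite -{2}[(2 ^+ _)^-1]mul1r -mulrDl ler_pM2r ?invr_gt0//; case: (beta _) => /=; lra.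
have lu m k : l k <= l m + (2 ^+ m)^-1.
  apply: le_trans (lmono k m) _; apply: le_trans _ (umono m k).
  by rewrite addnC lerDl invr_ge0 ltW.
have S0 : has_sup (range l).
  by split; [exists (l 0%N), 0%N|exists (l 0%N + (2 ^+ 0)^-1) => _ [k _ <-]].
pose x := sup (range l).
have lx m : l m < x.
  have [k mk bk] := inf m; apply: (@lt_le_trans _ _ (l k.+1)).
    rewrite lS bk; apply: (@le_lt_trans _ _ (l k)); last by rewrite ltrDl divr_gt0.
    by rewrite -(subnKC mk).
  by apply: sup_upper_bound => //; exists k.+1.
have xu m : x <= l m + (2 ^+ m)^-1.
  by apply: ge_sup; [exists (l 0%N), 0%N|move=> _ [k _ <-]].
have x01 : 0 < x <= 1.
  have := lx 0%N; have := xu 0%N.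
  by rewrite /l /v/= expr0 divr1 invr1 add0r => -> ->.
exists x => // m; apply: bits_unique => //; first by rewrite size_mkseq.
rewrite -/(v m) mulrC -ltr_pdivrMr// lx/= -ler_pdivlMr//.
have e : (v m).+1%:R = (v m)%:R + 1 :> R by rewrite natr1.
by rewrite e mulrDl mul1r; exact: xu.
Qed.

End Bits.

(** * Additive masses on the binary tree *)

Section TreeMeasure.
Variable R : realType.
Implicit Types (p : R^nat) (b c : seq bool) (r n m k : nat).

Definition tail p r : R := 1 - \sum_(k < r) p k.

(* Mass of the dyadic interval with binary digits [b] under the Bernoulli measure
   giving weight [p k] to the digit [k.+1], relative to [r] initial zeros; a
   digit [k.+1] is coded by [k] zeros followed by a one. *)
Fixpoint mass p r b : R := match b with
  | [::] => tail p r
  | false :: b' => mass p r.+1 b'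
  | true :: b' => p r * mass p 0 b'
  end.

Lemma tail0 p : tail p 0 = 1.
Proof. by rewrite /tail big_ord0 subr0. Qed.

Lemma tailS p r : tail p r = tail p r.+1 + p r.
Proof. by rewrite /tail big_ord_recr/=; ring. Qed.

Lemma mass_rcons p r b : mass p r (rcons b false) + mass p r (rcons b true) = mass p r b.
Proof.
elim: b r => [|[] b IH] r /=; first by rewrite tail0 mulr1 -tailS.
  by rewrite -mulrDr IH.
exact: IH.
Qed.

Lemma tail_sums p r : sums p 1 -> sums (fun k => if (k < r)%N then 0 else p k) (tail p r).
Proof.
move=> hp; have h2 : sums (fun k => if (k < r)%N then p k else 0) (\sum_(k < r) p k).
  split; apply: cvg_near_cst; near=> n.
  have rn : (r <= n)%N by near: n; exact: nbhs_infty_ge.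
  rewrite /series /= big_mkord -(big_mkord xpredT (fun k => if (k < r)%N then p k else 0)).
  rewrite (big_cat_nat (leq0n r) rn)/= [X in _ + X]big_nat_cond [X in _ + X]big1 ?addr0.
    by rewrite big_mkord; apply: eq_bigr => i _; rewrite ltn_ord.
  by move=> i /andP[/andP[ri _] _]; rewrite ltnNge ri.
apply: eq_sums (sumsB hp h2) => k.
by case: ifP; rewrite ?subrr ?subr0.
Unshelve. all: by end_near. Qed.

Lemma tail_ge0 p r : (forall k, 0 <= p k) -> sums p 1 -> 0 <= tail p r.
Proof. by move=> p0 hp; apply: sums_ge0 (tail_sums r hp) => k; case: ifP. Qed.

Lemma mass_ge0 p r b : (forall k, 0 <= p k) -> sums p 1 -> 0 <= mass p r b.
Proof.
move=> p0 hp; elim: b r => [|[] b IH] r /=; first exact: tail_ge0.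
  by rewrite mulr_ge0.
exact: IH.
Qed.

(** [z] counts the zeros still pending at the end of [b] and [C] collects its completed digits; a
    final run of zeros then affects the tail only. *)
Lemma mass_cat_zeros b r : exists z : nat, exists C : R^nat -> R,
  (forall p, (forall k, 0 < p k) -> 0 < C p) /\
  forall p n, mass p r (b ++ nseq n false) = C p * tail p (z + n).
Proof.
elim: b r => [|[] b IH] r /=.
- exists r, (fun=> 1); split=> // p n; rewrite mul1r.
  by elim: n r => [|n IH] r /=; rewrite ?addn0// IH addSnnS.
- have [z [C [C0 CE]]] := IH 0%N; exists z, (fun p => p r * C p).
  by split=> [p p0|p n]; [rewrite mulr_gt0// C0|rewrite CE mulrA].
- exact: IH.
Qed.

(** The mass of the intersection of two dyadic cells, which are nested or disjoint. *)
Definition restrict p c b : R :=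
  if (size c <= size b)%N then (if take (size c) b == c then mass p 0 b else 0)
  else (if take (size b) c == b then mass p 0 c else 0).

Lemma restrict_nil p c : restrict p c [::] = mass p 0 c.
Proof. by case: c => [|d c]; rewrite /restrict/=. Qed.

Lemma restrict_self p c : restrict p c c = mass p 0 c.
Proof. by rewrite /restrict leqnn take_size eqxx. Qed.

Lemma restrict_ge0 p c b : (forall k, 0 <= p k) -> sums p 1 -> 0 <= restrict p c b.
Proof. by move=> p0 hp; rewrite /restrict; case: ifP => _; case: ifP => _//; exact: mass_ge0. Qed.

Lemma restrict_rcons p c b :
  restrict p c (rcons b false) + restrict p c (rcons b true) = restrict p c b.
Proof.
rewrite /restrict !size_rcons; have [cb|bc] := leqP (size c) (size b).
  have tk d : take (size c) (rcons b d) = take (size c) b by rewrite -cats1 takel_cat.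
  rewrite (leqW cb) !tk; case: ifP => _; last by rewrite addr0.
  exact: mass_rcons.
have [d cE] : exists d, c = take (size b) c ++ d.
  by exists (drop (size b) c); rewrite cat_take_drop.
have sb : size (take (size b) c) = size b by rewrite size_take bc.
move: (take (size b) c) sb cE => b' sb cE; subst c.
rewrite size_cat sb in bc *; case: d bc => [|e d] bc; first by rewrite addn0 ltnn in bc.
have tk : take (size b).+1 (b' ++ e :: d) = rcons b' e.
  by rewrite -cat_rcons -sb -(size_rcons b' e) take_size_cat.
rewrite tk /= addnS; case: d bc tk => [|f d] bc tk.
  rewrite addn0 leqnn !take_oversize ?size_rcons//.
  rewrite cats1 !(eq_sym (rcons b _)) !eqseq_rcons.
  have [->|bb] := eqVneq b' b; last by rewrite addr0.
  by case: e {bc tk}; rewrite ?addr0 ?add0r.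
rewrite (_ : (_ < (size b).+1)%N = false); last first.
  by rewrite ltnS /= addnS ltnNge leq_addr.
rewrite !eqseq_rcons; have [_|_] := eqVneq b' b; last by rewrite addr0.
by case: e {bc tk}; rewrite /= ?addr0 ?add0r.
Qed.

(** The invariant is that the sum of all [N i] stays strictly below [M]. By additivity it cannot
    fail at both children of a node where it holds. *)
Lemma heavy_path (M : seq bool -> R) (N : nat -> seq bool -> R) :
  (forall b, M (rcons b false) + M (rcons b true) = M b) ->
  (forall i b, 0 <= N i b) ->
  (forall i b, N i (rcons b false) + N i (rcons b true) = N i b) ->
  (exists2 e, e < M [::] & forall n, \sum_(i < n) N i [::] <= e) ->
  exists beta : nat -> bool, forall m i, N i (mkseq beta m) < M (mkseq beta m).
Proof.
move=> Madd N0 Nadd [e eM Ne].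
pose good b := exists2 v, sums (N^~ b) v & v < M b.
have good0 : good [::].
  have [h1 h2] := sums_bounded (N0^~ [::]) Ne.
  by eexists; [exact: h1|exact: le_lt_trans eM].
have step b : good b -> good (rcons b false) \/ good (rcons b true).
  move=> [v hv vM].
  have dom (c : bool) : sums (N^~ (rcons b c)) (limn (series (N^~ (rcons b c)))).
    apply: (sums_dominated _ _ hv) => [i|i]; first exact: N0.
    by rewrite -(Nadd i b); case: c; rewrite ?lerDl ?lerDr.
  have h0 := dom false; have h1 := dom true.
  move: h0 h1; move: (limn _) (limn _) => v1 v0 h0 h1.
  have vE : v0 + v1 = v.
    by apply: sums_unique hv; apply: eq_sums (sumsD h0 h1) => i; exact: Nadd.
  have [lt0|ge0] := ltP v0 (M (rcons b false)); first by left; exists v0.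
  by right; exists v1 => //; have := Madd b; lra.
pose next b := ~~ `[< good (rcons b false) >].
have goodS b : good b -> good (rcons b (next b)).
  move=> /step; rewrite /next; case: asboolP => //= ng [|//].
  by move=> /ng.
pose path m := iter m (fun b => rcons b (next b)) [::].
pose beta m := next (path m).
have pathE m : path m = mkseq beta m by elim: m => // m IH; rewrite mkseqS -IH.
have goodP m : good (path m) by elim: m => //= m; exact: goodS.
exists beta => m i; rewrite -pathE; have [v hv] := goodP m.
exact: le_lt_trans (sums_term i (fun j => N0 j _) hv).
Qed.

End TreeMeasure.

(** * From binary digits to digits of T *)

Section DigitsAndBits.
Variable R : realType.
Implicit Types (x : R) (p : R^nat).

Lemma dbl_low x : 0 < x <= 2^-1 -> d1 x = (d1 (dbl x)).+1 /\ Tmap (dbl x) = Tmap x.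
Proof.
move=> /andP[x0 x2]; have dE : dbl x = 2 * x by rewrite /dbl ltNge x2/= subr0.
have b : 0 < 2 * x <= 1 by apply/andP; split; lra.
have /andP[h1 h2] := d1_bounds b.
have D : d1 x = (d1 (2 * x)).+1.
  apply: d1_eq; rewrite exprS.
  have -> : (2^-1) ^+ d1 (2 * x) = 2^-1 * (2^-1) ^+ (d1 (2 * x)).-1 :> R by rewrite -exprS.

  have e : (2^-1) ^+ d1 (2 * x) = 2^-1 * (2^-1) ^+ (d1 (2 * x)).-1 :> R by rewrite -exprS.
  rewrite e in h1; move: h1 h2; move: ((2^-1) ^+ _) => y h1 h2.
  by clear - h1 h2; apply/andP; split; lra.
by rewrite dE; split=> //; rewrite /Tmap D; move: (d1 _) => k; rewrite exprS; ring.
Qed.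

Lemma dbl_high x : 2^-1 < x <= 1 -> d1 x = 1%N /\ dbl x = Tmap x.
Proof.
move=> /andP[x0 x1]; have D : d1 x = 1%N by apply: d1_eq; rewrite expr1 expr0 x0.
by split=> //; rewrite /dbl /Tmap D x0 expr1.
Qed.

(** Induction on the first digit: each leading zero moves into [r], and the first one completes the
    digit. *)
Lemma mass_first_digit p r m x : 0 < x <= 1 ->
  mass p r (bits (d1 x + m) x) = p (r + (d1 x).-1)%N * mass p 0 (bits m (Tmap x)).
Proof.
move: {2}(d1 x) (erefl (d1 x)) => k; elim: k r x => [|k IH] r x dk hx; first by rewrite /d1 in dk.
have [x2|x2] := leP x 2^-1.
  have [D TE] : d1 x = (d1 (dbl x)).+1 /\ Tmap (dbl x) = Tmap x.
    by apply: dbl_low; rewrite x2; case/andP: hx => ->.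
  have xF : (2^-1 < x) = false by apply/negbTE; rewrite -leNgt.
  have -> : mass p r (bits (d1 x + m) x) = mass p r.+1 (bits (d1 (dbl x) + m) (dbl x)).
    by rewrite D addSn [bits _.+1 _]/= xF.
  rewrite IH ?dbl_bounds//; last by move: dk; rewrite D => -[].
  by rewrite TE D; congr (p _ * _); rewrite addSnnS.
have [D TE] : d1 x = 1%N /\ dbl x = Tmap x by apply: dbl_high; rewrite x2; case/andP: hx.
by rewrite D add1n /= x2 addn0 TE.
Qed.

Lemma mass_in_digit p r m x : 0 < x <= 1 -> (m < d1 x)%N ->
  mass p r (bits m x) = tail p (r + m).
Proof.
elim: m r x => [|m IH] r x hx md; first by rewrite addn0.
have [x2|x2] := leP x 2^-1.
  have [D TE] : d1 x = (d1 (dbl x)).+1 /\ Tmap (dbl x) = Tmap x.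
    by apply: dbl_low; rewrite x2; case/andP: hx => ->.
  by rewrite /= ltNge x2/= IH ?dbl_bounds ?addSnnS//; move: md; rewrite D ltnS.
have [D TE] : d1 x = 1%N /\ dbl x = Tmap x by apply: dbl_high; rewrite x2; case/andP: hx.
by move: md; rewrite D.
Qed.

Definition digit j x : nat := (d1 (iter j (@Tmap R) x)).-1.

Definition digit_sum n x : nat := \sum_(j < n) (digit j x).+1.

Lemma digitE j x : (digit j x).+1 = d1 (iter j (@Tmap R) x).
Proof. by []. Qed.

Lemma mass_digits p n m x : 0 < x <= 1 ->
  mass p 0 (bits (digit_sum n x + m) x) =
  (\prod_(j < n) p (digit j x)) * mass p 0 (bits m (iter n (@Tmap R) x)).
Proof.
move=> hx; elim: n m => [|n IH] m; first by rewrite /digit_sum !big_ord0 mul1r add0n.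
rewrite /digit_sum big_ord_recr/= -/(digit_sum n x) -addnA IH digitE.
rewrite mass_first_digit ?iter_Tmap_bounds// add0n big_ord_recr/= -mulrA.
by [].
Qed.

(** Every binary level falls inside some digit of T, so that a mass factors into completed digits
    and one tail. *)
Lemma bits_position m x : exists n r, m = (digit_sum n x + r)%N /\
  (r < d1 (iter n (@Tmap R) x))%N.
Proof.
elim: m => [|m [n [r [mE rd]]]].
  by exists 0%N, 0%N; rewrite /digit_sum big_ord0.
have [rd'|rd'] := ltnP r.+1 (d1 (iter n (@Tmap R) x)).
  by exists n, r.+1; rewrite mE addnS.
exists n.+1, 0%N; split=> //; rewrite addn0 mE /digit_sum big_ord_recr/= digitE.
by rewrite -addnS; congr (_ + _)%N; apply/eqP; rewrite eqn_leq rd.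
Qed.

Lemma leq_digit_sum n x : (n <= digit_sum n x)%N.
Proof.
elim: n => // n IH; rewrite /digit_sum big_ord_recr/= -/(digit_sum n x) addnS ltnS.
exact: leq_trans IH (leq_addr _ _).
Qed.

Lemma birkhoff_phi n x : birkhoff (@phi R) n x = \sum_(j < n) lnS R (digit j x).
Proof. by []. Qed.

End DigitsAndBits.

(** * Lower bound for the dimension *)

Section LowerBound.
Variables (R : realType) (t q xi : R).
Hypotheses (t0 : 0 < t) (tq : solves xi t q).
Implicit Types (x l s : R) (i k m n : nat).

Definition bern (p : R) k : R := wt t p k / L 0 t p.

Lemma bern_gt0 p k : 0 < bern p k.
Proof. by rewrite divr_gt0 ?wt_gt0 ?L0_gt0. Qed.

Lemma bern_ge0 p k : 0 <= bern p k.
Proof. exact/ltW/bern_gt0. Qed.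

Lemma bern_sums p : sums (bern p) 1.
Proof.
have := sumsZ (L 0 t p)^-1 (sumsL0 p t0); rewrite mulVf; last by rewrite gt_eqF// L0_gt0.
by apply: eq_sums => k; rewrite mulrC.
Qed.

Lemma prod_bern p n x : \prod_(j < n) bern p (digit j x) =
  expR (p * birkhoff (@phi R) n x - (digit_sum n x)%:R * (t * ln 2) - n%:R * ln (L 0 t p)).
Proof.
have bE k : bern p k = expR (p * lnS R k - k.+1%:R * (t * ln 2) - ln (L 0 t p)).
  by rewrite expRD expRN lnK// posrE L0_gt0.
under eq_bigr do rewrite bE; rewrite -expR_sum; congr expR.
rewrite birkhoff_phi /digit_sum natr_sum mulr_sumr mulr_suml -!sumrB.
by rewrite !sumrB sumr_const card_ord mulr_natl.
Qed.

Lemma mass_at_digits p n x : 0 < x <= 1 ->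
  mass (bern p) 0 (bits (digit_sum n x) x) = \prod_(j < n) bern p (digit j x).
Proof.
by move=> hx; have := mass_digits (bern p) n 0 hx; rewrite addn0 /= tail0 mulr1.
Qed.

Let lam i : R := i.+1%:R^-1.
(** These sum to 1/4: the two signs of the tilt together use 1/2 of the unit mass and leave room for
    the 1/4 granted to the cover. *)
Let c i : R := (2^-1) ^+ i.+3.

Let lam_gt0 i : 0 < lam i. Proof. by rewrite invr_gt0. Qed.
Let lam_le1 i : lam i <= 1. Proof. by rewrite invf_le1// ler1n. Qed.
Let c_gt0 i : 0 < c i. Proof. by rewrite exprn_gt0. Qed.

(* The martingale [mass (bern (q + l)) / mass (bern q)] along the digits of [x]
   is bounded, for two sequences of tilts [l] tending to [0]. *)
Definition typical x := 0 < x <= 1 /\ forall i m (sg : bool),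
  c i * mass (bern (q + (-1) ^+ sg * lam i)) 0 (bits m x) <= mass (bern q) 0 (bits m x).

(** The derivative of ln [L 0] in q is xi by tangency. An upper bound is enough because l takes both
    signs. *)
Lemma log_L0_quadratic : exists2 K : R, 0 <= K & forall l, `|l| <= 1 ->
  ln (L 0 t (q + l)) - ln (L 0 t q) <= l * xi + K * l ^+ 2.
Proof.
have [K K0 HK] := L_quadratic 0 q t0; have L0 := L0_gt0 q t0.
exists (K / L 0 t q) => [|l l1]; first by rewrite divr_ge0// ltW.
have := HK t (q + l); rewrite subrr normr0 mulr0 addr0 add0r addrAC subrr add0r => H.
have {}H := H (ltW (divr_gt0 t0 (ltr0Sn _ 1))) l1.
have := le_trans (ler_norm _) H; rewrite (proj2 tq) real_normK ?num_real// => h.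
have : L 0 t (q + l) <= L 0 t q * (1 + (l * xi + K / L 0 t q * l ^+ 2)).
  rewrite mulrDr mulr1 mulrDr !mulrA [L 0 t q * K]mulrC -mulrA -(mulrA K) divff ?gt_eqF//.
  by rewrite mulr1; lra.
move=> /le_trans => /(_ (L 0 t q * expR (l * xi + K / L 0 t q * l ^+ 2))).
rewrite ler_pM2l// expR_ge1Dx => /(_ isT).
by move=> h'; rewrite lerBlDl -ler_expR expRD !lnK ?posrE ?L0_gt0.
Qed.

(** At digit boundaries the logarithm of the mass ratio is l S_n - n (ln L(q+l) - ln L(q)), with S_n
    the Birkhoff sum, and typicality bounds it by -ln(c i). Use both signs of l and divide by
    [lam i]. *)
Lemma typical_deviation : exists2 K : R, 0 <= K & forall x i n, typical x ->
  `|birkhoff (@phi R) n x - n%:R * xi| <= n%:R * (K * lam i) + - ln (c i) / lam i.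
Proof.
have [K K0 HK] := log_L0_quadratic; exists K => // x i n [hx Tx].
have key (sg : bool) : (-1) ^+ sg * lam i * (birkhoff (@phi R) n x - n%:R * xi) <=
    n%:R * (K * lam i ^+ 2) - ln (c i).
  have := Tx i (digit_sum n x) sg; rewrite !mass_at_digits// !prod_bern.
  rewrite -{1}(lnK (c_gt0 i)) -expRD ler_expR.
  have := HK ((-1) ^+ sg * lam i); rewrite normrMsign (ger0_norm (ltW (lam_gt0 i))) lam_le1.
  move=> /(_ isT); rewrite exprMn sqrr_sign mul1r => h1 h2.
  have n0 : 0 <= n%:R :> R by [].
  have aux (lc l B D N A A' K2 : R) : lc + ((q + l) * B - D - N * A) <= q * B - D - N * A' ->
      N * (A - A') <= N * (l * xi + K2) -> l * (B - N * xi) <= N * K2 - lc.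
    by clear - q xi; lra.
  exact: aux h2 (ler_wpM2l n0 h1).
have p := lam_gt0 i.
have e : n%:R * (K * lam i) + - ln (c i) / lam i = (n%:R * (K * lam i ^+ 2) - ln (c i)) / lam i.
  by rewrite -/(lam i); field; rewrite gt_eqF.
rewrite e ler_norml ler_pdivlMr// -mulNr ler_pdivrMr//.
have := key false; have := key true; rewrite expr0 expr1 mul1r mulN1r.
have aux (a b y : R) : - a * y <= b -> a * y <= b -> - b <= y * a <= b.
  by move=> h1 h2; rewrite lerNl [y * a]mulrC -mulNr h1 h2.
exact: aux.
Qed.

Lemma lam_small (e : R) : 0 < e -> exists i, lam i < e.
Proof.
move=> e0; have : \forall i \near \oo, harmonic i < e.
  exact: (cvgr_lt _ (@cvg_harmonic R)).
by move=> /filter_ex.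
Qed.

Lemma typical_Ephi x : typical x -> Ephi xi x.
Proof.
move=> Tx; split; first exact: (proj1 Tx).
have [K K0 HK] := typical_deviation.
apply/cvgrPdist_le => e e0.
have [i iK] : exists i, lam i < e / (2 * (K + 1)).
  by apply: lam_small; rewrite divr_gt0// mulr_gt0// ltr_wpDl.
have Ki : K * lam i <= e / 2.
  apply: (@le_trans _ _ ((K + 1) * (e / (2 * (K + 1))))).
    by apply: ler_pM => //; [exact: ltW|rewrite lerDl|exact: ltW].
  by rewrite le_eqVlt; apply/orP; left; apply/eqP; field; rewrite gt_eqF// ltr_wpDl.
near=> n.
have n0 : 0 < n%:R :> R by rewrite ltr0n; near: n; exact: nbhs_infty_gt.
have nb : - ln (c i) / lam i <= n%:R * (e / 2).
  rewrite -ler_pdivrMr; last by rewrite divr_gt0.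
  by near: n; exact: nbhs_infty_ger.
have -> : xi - n%:R^-1 * birkhoff (@phi R) n x = - (n%:R^-1 * (birkhoff (@phi R) n x - n%:R * xi)).
  by rewrite mulrBr mulKf ?gt_eqF// opprB.
rewrite normrN normrM gtr0_norm ?invr_gt0// mulrC ler_pdivrMr//.
apply: le_trans (HK x i n Tx) _.
rewrite (_ : e * n%:R = n%:R * (e / 2) + n%:R * (e / 2)); last by field.
by apply: lerD => //; rewrite ler_pM2l.
Unshelve. all: by end_near. Qed.

(** Part of the exponent is given up: for k >= r the weight at t is at most 2^(-r s) times the
    weight at t - s, which is still summable. *)
Lemma tail_bern_le s r : 0 < s < t ->
  tail (bern q) r <= L 0 (t - s) q / L 0 t q * expR (- (r%:R * (s * ln 2))).
Proof.
move=> /andP[s0 st]; have L0 := L0_gt0 q t0; have l2 := ln2_gt0 R.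
have ts : 0 < t - s by rewrite subr_gt0.
have h1 := tail_sums r (bern_sums q).
have h2 := sumsZ ((L 0 t q)^-1 * expR (- (r%:R * (s * ln 2)))) (sumsL0 q ts).
rewrite (_ : _ / _ * _ = (L 0 t q)^-1 * expR (- (r%:R * (s * ln 2))) * L 0 (t - s) q); last by ring.
apply: ler_sums h1 h2 => k; case: ltnP => kr.
  by rewrite !mulr_ge0 ?expR_ge0 ?invr_ge0 ?wt_ge0 ?ltW.
rewrite /bern mulrC -mulrA ler_pM2l ?invr_gt0// /wt -expRD ler_expR.
have : r%:R <= k.+1%:R :> R by rewrite ler_nat (leq_trans kr).
have sl : 0 < s * ln 2 by rewrite mulr_gt0.
rewrite -(ler_pM2r sl); lra.
Qed.

(** A Frostman-type bound. Completed digits of total D give 2^(-D t) exp(q (S_n - n xi)), with S_n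
    the Birkhoff sum; as n <= D, the deviation is paid from the surplus t - s. The unfinished digit
    is left to [tail_bern_le]. *)
Lemma typical_mass s : 0 < s < t -> exists2 C : R, 0 < C & forall x m, typical x ->
  mass (bern q) 0 (bits m x) <= C * expR (- (m%:R * (s * ln 2))).
Proof.
move=> /andP[s0 st]; have L0 := L0_gt0 q t0; have l2 := ln2_gt0 R.
have ts : 0 < t - s by rewrite subr_gt0.
have [K K0 HK] := typical_deviation.
have D0 : 0 < (`|q| + 1) * (K + 1) by rewrite mulr_gt0// ltr_wpDl.
have [i ile] : exists i, lam i < (t - s) * ln 2 / ((`|q| + 1) * (K + 1)).
  by apply: lam_small; rewrite divr_gt0// mulr_gt0.
have qK : `|q| * (K * lam i) <= (t - s) * ln 2.
  rewrite ltr_pdivlMr// in ile; apply: le_trans (ltW ile).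
  rewrite mulrA [leRHS]mulrC ler_pM2r//; apply: ler_pM => //; by rewrite lerDl.
exists (expR (`|q| * (- ln (c i) / lam i)) * (L 0 (t - s) q / L 0 t q)).
  by rewrite mulr_gt0 ?expR_gt0 ?divr_gt0 ?L0_gt0.
move=> x m Tx; have hx := proj1 Tx.
have [n [r [-> rd]]] := bits_position m x.
rewrite mass_digits// mass_in_digit ?iter_Tmap_bounds// add0n.
rewrite natrD mulrDl opprD expRD mulrACA.
have st' : 0 < s < t by rewrite s0.
apply: ler_pM; rewrite ?tail_bern_le ?tail_ge0//; try exact: bern_ge0; try exact: bern_sums.
  by rewrite prodr_ge0// => j _; exact: bern_ge0.
rewrite prod_bern -expRD ler_expR (proj1 tq) expRK.
have dev := HK x i n Tx.
have h1 : q * (birkhoff (@phi R) n x - n%:R * xi) <=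
    `|q| * (n%:R * (K * lam i) + - ln (c i) / lam i).
  by apply: le_trans (ler_norm _) _; rewrite normrM ler_wpM2l.
have h2 : n%:R * (`|q| * (K * lam i)) <= (digit_sum n x)%:R * ((t - s) * ln 2).
  apply: ler_pM => //; first by rewrite mulr_ge0// mulr_ge0// ltW.
  by rewrite ler_nat leq_digit_sum.
have aux (B Z D l2' aq N k : R) : q * (B - N * xi) <= aq * (N * k + Z) ->
    N * (aq * k) <= D * ((t - s) * l2') ->
    q * B - D * (t * l2') - N * (q * xi) <= aq * Z - D * (s * l2').
  by clear - t s q xi; lra.
exact: aux h1 h2.
Qed.

(** Tilting by l > 0 multiplies the weight of digit k+1 by (k+1)^l, up to normalisation, so it beats
    any constant on large digits. *)
Lemma zeros_not_dominated l (C : R) : 0 < l -> 0 < C -> exists n0, forall n, (n0 <= n)%N ->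
  tail (bern q) n < C * tail (bern (q + l)) n.
Proof.
move=> l0 C0; have L0 := L0_gt0 q t0; have L0l := L0_gt0 (q + l) t0.
(* [bern q k < C * bern (q + l) k] amounts to (k+1)^l > B. *)
pose B := L 0 t (q + l) / (C * L 0 t q).
have B0 : 0 < B by rewrite divr_gt0// mulr_gt0.
pose n0 := Num.bound (expR (ln B / l)).
have hn : ln B < l * lnS R n0.
  rewrite mulrC -ltr_pdivrMr// -ltr_expR expR_lnS.
  have := archi_boundP (expR_ge0 (ln B / l)); rewrite -/n0 => /lt_trans; apply.
  by rewrite ltr_nat.
exists n0 => n n0n.
have h1 := tail_sums n (bern_sums q).
have h2 := sumsZ C (tail_sums n (bern_sums (q + l))).
have key k : (n <= k)%N -> bern q k < C * bern (q + l) k.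
  move=> nk; rewrite /bern wt_tilt.
  have CL : 0 < C * L 0 t q by rewrite mulr_gt0.
  have : B < expR (l * lnS R k).
    rewrite -[B]lnK// ltr_expR; apply: lt_le_trans hn _; rewrite ler_pM2l//.
    by rewrite ler_ln ?posrE// ler_nat ltnS (leq_trans n0n).
  rewrite ltr_pdivrMr// => h; rewrite ltr_pdivrMr//.
  rewrite [ltRHS](_ : _ = wt t q k * (expR (l * lnS R k) * (C * L 0 t q) / L 0 t (q + l))); last by ring.
  by rewrite ltr_pMr ?wt_gt0// ltr_pdivlMr// mul1r.
apply: (ltr_sums (n := n) _ _ h1 h2) => [k|]; last by rewrite ltnn key.
by case: ltnP => kn; rewrite ?mulr0// ltW// key.
Qed.

(* A path along which all the competing masses stay below [mass (bern q)] has
   infinitely many ones (by [zeros_not_dominated]), is typical, and avoids every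
   cell charged by a [restrict] term. *)
Lemma typical_point_avoiding (cs : nat -> seq (seq bool)) :
  (forall n, \sum_(i < n) \sum_(b <- cs i) mass (bern q) 0 b <= 4^-1) ->
  exists2 x, typical x & forall i m, bits m x \notin cs i.
Proof.
move=> csle.
have mge p b : 0 <= mass (bern p) 0 b by apply: mass_ge0 (bern_sums p); exact: bern_ge0.
pose N i b := c i * mass (bern (q + (-1) ^+ false * lam i)) 0 b +
  c i * mass (bern (q + (-1) ^+ true * lam i)) 0 b + \sum_(d <- cs i) restrict (bern q) d b.
have rge i b : 0 <= \sum_(d <- cs i) restrict (bern q) d b.
  by apply: sumr_ge0 => d _; apply: restrict_ge0 (bern_sums q); exact: bern_ge0.
have cge i p b : 0 <= c i * mass (bern p) 0 b by apply: mulr_ge0; [exact/ltW/c_gt0|exact: mge].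
have [||||beta hb] := @heavy_path R (mass (bern q) 0) N.
- by move=> b; exact: mass_rcons.
- by move=> i b; rewrite !addr_ge0.
- move=> i b; rewrite /N -[in RHS](mass_rcons (bern (q + (-1) ^+ false * lam i)) 0 b).
  rewrite -[in RHS](mass_rcons (bern (q + (-1) ^+ true * lam i)) 0 b).
  under [X in _ = _ + X]eq_bigr do rewrite -restrict_rcons.
  by rewrite big_split/= !mulrDr addrACA [X in X + _ = _]addrACA.
(* At the root each sign of the tilt contributes at most 1/4, and so does the cover. *)
- exists (3 / 4); first by rewrite /= tail0; lra.
  move=> n; rewrite /N !big_split/=.
  have c4 : \sum_(i < n) c i <= 4^-1.
    have -> : \sum_(i < n) c i = 4^-1 - (2^-1) ^+ n / 4.
      elim: n {csle} => [|n IH]; first by rewrite big_ord0 expr0; lra.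
      by rewrite big_ord_recr/= IH /c !exprS; lra.
    by rewrite gerBl divr_ge0// exprn_ge0.
  have e : \sum_(i < n) c i * tail (bern (q + (-1) ^+ false * lam i)) 0 = \sum_(i < n) c i.
    by apply: eq_bigr => i _; rewrite tail0 mulr1.
  have e' : \sum_(i < n) c i * tail (bern (q + (-1) ^+ true * lam i)) 0 = \sum_(i < n) c i.
    by apply: eq_bigr => i _; rewrite tail0 mulr1.
  rewrite e e'.
  have -> : \sum_(i < n) \sum_(d <- cs i) restrict (bern q) d [::] =
      \sum_(i < n) \sum_(b <- cs i) mass (bern q) 0 b.
    by apply: eq_bigr => i _; apply: eq_bigr => d _; rewrite restrict_nil.
  by apply: le_trans (lerD (lerD c4 c4) (csle n)) _; lra.
have lt1 m i (sg : bool) : c i * mass (bern (q + (-1) ^+ sg * lam i)) 0 (mkseq beta m) <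
    mass (bern q) 0 (mkseq beta m).
  apply: le_lt_trans (hb m i); rewrite /N.
  have := rge i (mkseq beta m); have := cge i (q + (-1) ^+ false * lam i) (mkseq beta m).
  have := cge i (q + (-1) ^+ true * lam i) (mkseq beta m) => ? ? ?.
  by case: sg; rewrite -addrA; [rewrite [leRHS]addrCA|]; rewrite lerDl addr_ge0.
have inf m : exists2 k, (m <= k)%N & beta k.
  apply: contrapT => no.
  have bF k : (m <= k)%N -> beta k = false.
    by move=> mk; apply/negbTE/negP => bk; apply: no; exists k.
  have [z [C [C0 CE]]] := mass_cat_zeros R (mkseq beta m) 0.
  have mk n : mkseq beta (m + n) = mkseq beta m ++ nseq n false.
    elim: n => [|n IH]; first by rewrite addn0 cats0.
    by rewrite -[in RHS]addn1 nseqD catA -IH addnS mkseqS bF ?leq_addr// cats1.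
  have Cq := C0 _ (bern_gt0 q); have Cl := C0 _ (bern_gt0 (q + lam 0)).
  (* With this constant, [zeros_not_dominated] contradicts [lt1] on a path ending in zeros. *)
  have k0 : 0 < c 0 * C (bern (q + lam 0)) / C (bern q) by rewrite divr_gt0// mulr_gt0.
  have [n hn] := zeros_not_dominated (lam_gt0 0) k0.
  have := lt1 (m + n)%N 0%N false; rewrite expr0 mul1r mk !CE.
  move=> h2; have := hn (z + n)%N (leq_addl _ _); rewrite -(ltr_pM2l Cq) => h1.
  have := lt_trans h2 h1.
  rewrite [ltRHS](_ : _ = c 0 * (C (bern (q + lam 0)) * tail (bern (q + lam 0)) (z + n))).
    by rewrite ltxx.
  by rewrite mulrCA -!mulrA; congr (_ * (_ * _)); rewrite mulKf ?gt_eqF.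
have [x hx bx] := point_of_path R inf.
exists x; first by split=> // i m sg; rewrite bx ltW.
move=> i m; rewrite bx; apply/negP => mem.
have := hb m i; apply/negP; rewrite -leNgt /N.
rewrite (big_rem _ mem)/= restrict_self.
have : 0 <= \sum_(d <- rem (mkseq beta m) (cs i)) restrict (bern q) d (mkseq beta m).
  by apply: sumr_ge0 => d _; apply: restrict_ge0 (bern_sums q); exact: bern_ge0.
have := cge i (q + (-1) ^+ false * lam i) (mkseq beta m).
have := cge i (q + (-1) ^+ true * lam i) (mkseq beta m); lra.
Qed.

(** Each set of the cover is replaced by at most two dyadic cells of comparable size. By
    [typical_mass] these carry total mass at most 1/4, so a typical point avoids them, although it
    lies in the covered set. *)
Lemma Ephi_not_null s : 0 < s < t -> ~ hausdorff_null s (Ephi xi).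
Proof.
move=> st; have /andP[s0 _] := st; have l2 := ln2_gt0 R.
have [C C0 HC] := typical_mass st.
(* For a set of positive diameter the chosen cells are shorter than twice that diameter, whence the
   factor 2^s. *)
pose S2 := 2 `^ s : R.
have S20 : 0 < S2 by rewrite powR_gt0.
(* The total mass 2 C (S2 eps + eps) is then at most 1/4, and all diameters are at most 1. *)
pose eps := Num.min 1 (8 * C * (S2 + 1))^-1.
have D0 : 0 < 8 * C * (S2 + 1) by rewrite !mulr_gt0// addr_gt0.
have eps0 : 0 < eps by rewrite lt_min ltr01 invr_gt0.
have eps1 : eps <= 1 by rewrite ge_min lexx.
have epsD : eps * (8 * C * (S2 + 1)) <= 1.
  by rewrite -ler_pdivlMr// mul1r ge_min lexx orbT.
move=> /(_ eps eps0)[U [cover [Ud Us]]].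
have lvl i : exists m, diam (U i) <= (2^-1) ^+ m /\
    expR (- (m%:R * (s * ln 2))) <= S2 * diam (U i) `^ s + eps * (2^-1) ^+ i.+1.
  have e0 : 0 < eps * (2^-1) ^+ i.+1 by rewrite mulr_gt0// exprn_gt0.
  (* A set of diameter 0 has no scale of its own; its level is taken so deep that the bound fits a
     summable allowance. *)
  have [d0|d0] := eqVneq (diam (U i)) 0.
    have cv : expR (- (s * ln 2)) ^+ m @[m --> \oo] --> 0.
      by apply: cvg_expr; rewrite ger0_norm ?expR_ge0// expR_lt1 oppr_lt0 mulr_gt0.
    have : \forall m \near \oo, expR (- (s * ln 2)) ^+ m <= eps * (2^-1) ^+ i.+1.
      exact: (cvgr_le _ cv).
    move=> /filter_ex[m hm]; exists m; rewrite d0 exprn_ge0//; split=> //.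
    by rewrite -mulrN expRM_natl; apply: le_trans hm _; rewrite lerDr mulr_ge0 ?powR_ge0 ?ltW.
  have dpos : 0 < diam (U i) <= 1.
    rewrite lt_def d0 diam_ge0/=; apply: le_trans eps1.
    by apply: diam_ub (Ud i); exact: ltW.
  (* [d1] serves as a dyadic logarithm of the diameter. *)
  have /andP[h1 h2] := d1_bounds dpos; exists (d1 (diam (U i))).-1; split=> //.
  have p : 0 < diam (U i) by case/andP: dpos.
  apply: (@le_trans _ _ (S2 * diam (U i) `^ s)); last by rewrite lerDl ltW.
  rewrite /S2 -powRM ?(ltW p)//.
  have -> : expR (- ((d1 (diam (U i))).-1%:R * (s * ln 2))) =
     ((2^-1) ^+ (d1 (diam (U i))).-1) `^ s.
    by rewrite expR_half -expRM; congr expR; ring.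
  apply: ge0_ler_powR; rewrite ?nnegrE ?exprn_ge0 ?mulr_ge0 ?(ltW s0) ?(ltW p)//.
  by rewrite -ler_pdivrMl// -exprS; exact: ltW h1.
have [M HM] := choice lvl.
have cells i : exists cs : seq (seq bool), [/\ (size cs <= 2)%N,
    (forall b, b \in cs -> exists2 x, (U i `&` typical) x & b = bits (M i) x) &
    (forall x, (U i `&` typical) x -> bits (M i) x \in cs)].
  apply: small_set_two_cells => [x [_ []]//|x y [Ux _] [Uy _]].
  by apply: le_trans (HM i).1; apply: le_diam (Ud i) Ux Uy.
have [cs Hcs] := choice cells.
have [|x Tx hx] := @typical_point_avoiding cs.
  move=> n; apply: (@le_trans _ _ (\sum_(i < n) 2 * C * (S2 * diam (U i) `^ s + eps * (2^-1) ^+ i.+1))).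
    apply: ler_sum => i _; have [sz csT _] := Hcs i.
    apply: (@le_trans _ _ (\sum_(b <- cs i) C * (S2 * diam (U i) `^ s + eps * (2^-1) ^+ i.+1))).
      rewrite big_seq [leRHS]big_seq; apply: ler_sum => b /csT[x [_ Tx] ->].
      apply: le_trans (HC x (M i) Tx) _; rewrite ler_pM2l//; exact: (HM i).2.
    rewrite big_const_seq count_predT iter_addr_0 -[leLHS]mulr_natl -[leRHS]mulrA.
    rewrite ler_wpM2r//.
      rewrite mulr_ge0 ?(ltW C0)// addr_ge0// mulr_ge0 ?powR_ge0 ?exprn_ge0 ?ltW//.
    by rewrite ler_nat.
  rewrite -mulr_sumr big_split/= -!mulr_sumr.
  have g : \sum_(i < n) (2^-1) ^+ i.+1 <= 1 :> R.
    have -> : \sum_(i < n) (2^-1) ^+ i.+1 = 1 - (2^-1) ^+ n :> R.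
      elim: n => [|n IH]; first by rewrite big_ord0 expr0 subrr.
      by rewrite big_ord_recr/= IH !exprS; lra.
    by rewrite gerBl exprn_ge0.
  have h1 : S2 * (\sum_(i < n) diam (U i) `^ s) <= S2 * eps by rewrite ler_pM2l.
  have h2 : eps * (\sum_(i < n) (2^-1) ^+ i.+1) <= eps by rewrite -[leRHS]mulr1 ler_pM2l.
  apply: (@le_trans _ _ (2 * C * (S2 * eps + eps))).
    by rewrite ler_pM2l ?mulr_gt0//; exact: lerD.
  have -> : 2 * C * (S2 * eps + eps) = eps * (8 * C * (S2 + 1)) / 4 by field.
  by rewrite ler_pdivrMr// mulVf.
have [i _ Ux] := cover x (typical_Ephi Tx).
have [_ _ csU] := Hcs i.
by have := hx i (M i); rewrite csU.
Qed.

End LowerBound.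

(** * The Lebesgue mean of log d_1 *)

Section Integral.
Variable R : realType.

(** [phi] is constant on (2^(-k-1), 2^(-k)], whose length 2^(-k-1) is the weight at (1, 0). *)
Lemma integral_phi :
  (\int[lebesgue_measure]_(x in `]0%R, 1%R]) (@phi R x)%:E)%E = (L 1 1 0)%:E.
Proof.
pose I k : set R := `](2^-1) ^+ k.+1, (2^-1) ^+ k]%classic.
have IE : `]0%R, 1%R]%classic = \bigcup_k I k.
  apply/seteqP; split=> x /=.
    rewrite in_itv/= => hx; have := d1_bounds hx.
    by exists (d1 x).-1 => //; rewrite /I /= in_itv/= {1}/d1.
  move=> [k _]; rewrite /I /= !in_itv/= => /andP[h1 h2].
  rewrite (lt_trans _ h1) ?exprn_gt0//=; apply: le_trans h2 _.
  by rewrite exprn_ile1//; lra.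
have phiI k x : I k x -> phi x = lnS R k.
  by rewrite /I /= in_itv/= => /d1_eq dE; rewrite /phi dE.
have tI : trivIset setT I.
  apply: ltn_trivIset => i j ij; apply/seteqP; split => // x [xi xj].
  have := xi; have := xj; rewrite /I /= !in_itv/= => /d1_eq d1j /d1_eq.
  by rewrite d1j => -[ji]; move: ij; rewrite ji ltnn.
have mI k : measurable (I k) by exact: measurable_itv.
rewrite IE ge0_integral_bigcup//=; last first.
- by move=> x _; rewrite lee_fin ln_ge0// ler1n /d1.
- apply/measurable_EFinP; apply/measurable_fun_bigcup => // k.
  apply: (eq_measurable_fun (fun=> lnS R k)); last exact: measurable_cst.
  by move=> x /set_mem /phiI.
have -> : (\sum_(0 <= k <oo) \int[lebesgue_measure]_(x in I k) (phi x)%:E =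
    \sum_(0 <= k <oo) (lnS R k ^+ 1 * wt 1 0 k)%:E)%E.
  apply: eq_eseriesr => k _.
  rewrite (eq_integral (fun=> (lnS R k)%:E)); last by move=> x /set_mem /phiI ->.
  have lt : (2^-1) ^+ k.+1 < (2^-1) ^+ k :> R.
    by rewrite exprS gtr_pMl ?exprn_gt0//; lra.
  have muI : lebesgue_measure (I k) = ((2^-1) ^+ k - (2^-1) ^+ k.+1)%:E.
    by rewrite /I lebesgue_measure_itv/= lte_fin lt -EFinD.
  have -> : (\int[lebesgue_measure]_(_ in I k) (lnS R k)%:E =
      (lnS R k)%:E * lebesgue_measure (I k))%E by rewrite integral_cst; [by []|exact: mI].
  rewrite muI -EFinM; congr EFin; rewrite expr1; congr (_ * _).
  rewrite /wt mul0r sub0r mul1r -expR_half exprS; lra.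
have /sums_cvg h := sumsL 1 0 (@ltr01 R).
rewrite [in RHS]/L -EFin_lim; last exact: cvgP h.
by apply: congr_lim; apply/funext => N /=; rewrite /series/= sumEFin.
Qed.

End Integral.

(** * The pressure system and the dimension *)

Section Pressure.
Variable R : realType.
Implicit Types (t q xi : R).

Lemma P_is_derive t q : 0 < t -> is_derive q 1 (P t) (L 1 t q / L 0 t q).
Proof.
move=> t0; have -> : P t = (@ln R) \o L 0 t.
  by apply/funext => p; rewrite /= P_L0.
rewrite mulrC; apply: is_derive1_comp; first exact/is_derive1_ln/L0_gt0.
apply: has_slope_derive; have [A [B [H cAB]]] := L_increment 0 q t0.
exists (B t).
  near=> p; rewrite (H t p); first by rewrite subrr mulr0 add0r mulrC.
    by rewrite subrr normr0 divr_ge0// ltW.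
  by rewrite distrC; apply/ltW; near: p; exact: near_dist_lt.
apply: (cAB R (nbhs q) _ (fun=> t) id _ _).2; [exact: cvg_cst|exact: cvg_id].
Unshelve. all: by end_near. Qed.

Lemma derive1_P t q : 0 < t -> derive1 (P t) q = L 1 t q / L 0 t q.
Proof. by move=> /(P_is_derive q) h; rewrite derive1E (derive_val (is_derive := h)). Qed.

Lemma solves_pressure xi t q : 0 < t ->
  solves xi t q <-> P t q = q * xi /\ derive1 (P t) q = xi.
Proof.
move=> t0; have L0 := L0_gt0 q t0; rewrite P_L0// derive1_P//; split=> [[-> ->]|[PE DE]].
  by rewrite expRK mulfK ?gt_eqF ?expR_gt0.
split; first by rewrite -PE lnK.
by rewrite -DE divfK// gt_eqF.
Qed.

(** Exponents below t are excluded by [Ephi_not_null]; for t + e the same q works, since [L 0]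
    decreases strictly in t. *)
Lemma dimH_Ephi xi t q : 0 < t -> solves xi t q -> dimH (Ephi xi) = t.
Proof.
move=> t0 h.
have lb : lbound [set s : R | 0 < s /\ hausdorff_null s (Ephi xi)] t.
  move=> s [s0 hs]; rewrite leNgt; apply/negP => st.
  by apply: (Ephi_not_null t0 h _ hs); rewrite s0.
have mem e : 0 < e -> 0 < t + e /\ hausdorff_null (t + e) (Ephi xi).
  move=> e0; have te : 0 < t + e by rewrite addr_gt0.
  split=> //; apply: (hausdorff_null_Ephi (q := q)) => //.
  by rewrite -(proj1 h) L0_lt// ltrDl.
apply/eqP; rewrite eq_le; apply/andP; split.
  by apply/ler_addgt0Pr => e /mem te; apply: ge_inf => //; exists t.
by apply: lb_le_inf => //; exists (t + 1); exact: mem.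
Qed.

(** At xi = 0 there is no tangency to rely on; instead, for every e > 0, some q has [L 0 e q] < 1 =
    exp(0). *)
Lemma dimH_Ephi0 : dimH (@Ephi R 0) = 0.
Proof.
have mem e : 0 < e -> 0 < e /\ hausdorff_null e (@Ephi R 0).
  move=> e0; have [q _ hq] := L0_lt1 e0; split=> //.
  by apply: (hausdorff_null_Ephi (q := q)) => //; rewrite mulr0 expR0.
have lb : lbound [set s : R | 0 < s /\ hausdorff_null s (Ephi 0)] 0.
  by move=> s [/ltW].
apply/eqP; rewrite eq_le; apply/andP; split.
  by apply/ler_addgt0Pr => e /mem te; rewrite add0r; apply: ge_inf => //; exists 0.
by apply: lb_le_inf => //; exists 1; exact: mem.
Qed.

End Pressure.

Theorem theorem1p3 (R : realType) :
  (forall t q : R, pdom t q ->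
     pseq t q @ \oo -->
       ln (limn (fun N : nat => \sum_(1 <= k < N) (2 `^ (- (k%:R * t)) * k%:R `^ q)))) /\
  exists tf qf : R -> R,
    (forall xi : R, 0 < xi ->
       [/\ pdom (tf xi) (qf xi),
           P (tf xi) (qf xi) = qf xi * xi,
           derivable (P (tf xi)) (qf xi) 1,
           derive1 (P (tf xi)) (qf xi) = xi &
           forall t q : R, pdom t q -> P t q = q * xi ->
             derivable (P t) q 1 -> derive1 (P t) q = xi ->
             t = tf xi /\ q = qf xi]) /\
    dimH (@Ephi R 0) = 0 /\
    (forall xi : R, 0 < xi -> dimH (Ephi xi) = tf xi) /\
    (forall xi0 : R,
       (\int[lebesgue_measure]_(x in `]0%R, 1%R]) (phi x)%:E)%E = xi0%:E ->
       [/\ tf xi0 = 1,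
           (forall xi, 0 < xi -> derivable tf xi 1)
           /\ (forall xi, 0 < xi < xi0 -> 0 < derive1 tf xi)
           /\ derive1 tf xi0 = 0
           /\ (forall xi, xi0 < xi -> derive1 tf xi < 0),
           tf x @[x --> 0^'+] --> 0 /\ tf x @[x --> +oo] --> 0,
           derive1 tf x @[x --> 0^'+] --> +oo &
           (derivable (derive1 tf) xi0 1 /\ derive1 (derive1 tf) xi0 < 0) /\
           exists xi1, xi0 < xi1 /\ derivable (derive1 tf) xi1 1 /\ 0 < derive1 (derive1 tf) xi1]).
Proof.
split=> [t q /pdom_sums[s h]|]; first by rewrite (sums_limn_powR h); exact: sums_pseq.
have [f Hf] : exists f : R -> R * R, forall xi : R, 0 < xi ->
    [/\ 0 < (f xi).1, (f xi).1 <= 1 & solves xi (f xi).1 (f xi).2].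
  suff : forall xi : R, exists p : R * R, 0 < xi -> [/\ 0 < p.1, p.1 <= 1 & solves xi p.1 p.2].
    by move=> /choice[f Hf]; exists f.
  (* [choice] needs a total function; for xi <= 0 the pair is a dummy. *)
  move=> xi; have [xi0|xi0] := ltP 0 xi; last by exists (0, 0).
  by have [t [q h]] := solves_exists xi0; exists (t, q).
pose tf xi := (f xi).1; pose qf xi := (f xi).2.
have tqP (xi : R) : 0 < xi -> [/\ 0 < tf xi, tf xi <= 1 & solves xi (tf xi) (qf xi)] by exact: Hf.
exists tf, qf; split; [|split; [exact: dimH_Ephi0|split]].
- move=> xi xi0; have [t0 _ h] := tqP xi xi0.
  have [PE DE] := (solves_pressure xi (qf xi) t0).1 h.
  split=> //; first exact: pdom_pos.
    by have D := P_is_derive (qf xi) t0; exact: ex_derive.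
  move=> t q dom PE' _ DE'; have [t'0|t'0] := ltP 0 t.
    by apply: (solves_unique t'0 t0 _ h); exact/solves_pressure.
  by have := pdom_nonpos xi0 t'0 dom PE'.
- by move=> xi /tqP[t0 _ h]; exact: dimH_Ephi h.
move=> xi0; rewrite integral_phi => -[<-]; split.
- exact: (tf_xi0 tqP).1.
- split; first by move=> xi /(tf_derivable tqP)[].
  split; first exact: (derive1_tf_gt0 tqP).
  by split; [exact: (derive1_tf_xi0 tqP)|exact: (derive1_tf_lt0 tqP)].
- by split; [exact: (tf_cvg0 tqP)|exact: (tf_cvgy tqP)].
- exact: (derive1_tf_cvg0 tqP).
- by split; [exact: (derive2_tf_xi0 tqP)|exact: (derive2_tf_pos tqP)].
Qed.
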